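(* Let $t\neq 2$ be a prime number. If $\sigma\neq e$ is a normal braid indivisible by $\Delta$, then in at least one row of the matrix $\beta_4(\sigma)$, the leading coefficients of multiple (that is, at least two) entries are non-zero modulo $t$.
   Context: $B_4=\langle \sigma_1,\sigma_2,\sigma_3 : \sigma_1\sigma_2\sigma_1=\sigma_2\sigma_1\sigma_2,\ \sigma_2\sigma_3\sigma_2=\sigma_3\sigma_2\sigma_3,\ \sigma_1\sigma_3=\sigma_3\sigma_1\rangle$ is the braid group on four strands, with identity $e$. The (reduced) Burau representation $\beta_4:B_4\to \mathrm{GL}_3(\mathbb{Z}[q^{\pm1}])$ is the homomorphism with $$\sigma_1\mapsto\begin{pmatrix} q&0&0\\-q&1&0\\0&0&1\end{pmatrix},\quad \sigma_2\mapsto\begin{pmatrix}1&1&0\\0&q&0\\0&-q&1\end{pmatrix},\quad \sigma_3\mapsto\begin{pmatrix}1&0&0\\0&1&1\\0&0&q\end{pmatrix}.$$ A positive braid is an element of the submonoid of $B_4$ generated by $\sigma_1,\sigma_2,\sigma_3$; for positive $\sigma$ the entries of $\beta_4(\sigma)$ lie in $\mathbb{Z}[q]$, and the leading coefficient of an entry is the coefficient of its highest power of $q$ (an entry equal to $0$ is not counted). The Garside element is $\Delta=(\sigma_1\sigma_2\sigma_3)(\sigma_1\sigma_2)\sigma_1$, and a positive braid $\sigma$ is indivisible by $\Delta$ if $\sigma\ne\Delta\tau$ for every positive braid $\tau$. A product expansion of a positive braid $\sigma$ is an expression of $\sigma$ as a word in $\sigma_1,\sigma_2,\sigma_3$ (positive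 powers only; words are read from left to right; all expansions of $\sigma$ have the same length). The minimal form of $\sigma$ is the product expansion whose sequence of generator indices, read from left to right, is lexicographically minimal among all product expansions of $\sigma$. It is written $\sigma=\prod_{i=1}^n\sigma_1^{a_i}\sigma_3^{b_i}\sigma_2^{c_i}$ with $a_i,b_i,c_i\geq 0$, where $a_i+b_i>0$ for $2\leq i\leq n$ and $c_i>0$ for $1\leq i\leq n-1$. The positive braid $\sigma$, with minimal form $\sigma=\prod_{i=1}^n\sigma_1^{a_i}\sigma_3^{b_i}\sigma_2^{c_i}$ (where $a_i,b_i,c_i\geq 0$, $a_i+b_i>0$ for $2\leq i\leq n$ and $c_i>0$ for $1\leq i\leq n-1$), is a normal braid if the following hold for each $p<n$ (a clause involving the index $p-1$ is imposed only when $p\geq 2$): (i) If $a_p=0$ and $b_p=1$, then $c_p\neq 1,2$. If $a_p=0$, $b_p=1$ and $a_{p-1}+1\geq c_p$, then $c_{p-1}\neq 1$. (ii) If $b_p>0$, $a_p\geq b_p+1$ and $c_p=1$, then $a_{p+1}\neq 2$. If $a_p=1$, $b_p=1$ and $c_p=1$, then $a_{p+1}\neq 2$. *)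

(* Defs.v *)
From HB Require Import structures.
From mathcomp Require Import all_boot all_order all_algebra.
From mathcomp Require Import boolp ring.

Set Implicit Arguments.
Unset Strict Implicit.
Unset Printing Implicit Defensive.

Import Order.TTheory GRing.Theory.
Local Open Scope quotient_scope.
Local Open Scope group_scope.

(* The generator indices 1, 2, 3 are the elements 0, 1, 2 of 'I_3; the shift  *)
(* is increasing, hence irrelevant to lexicographic comparisons.              *)
Definition s1 : 'I_3 := @Ordinal 3 0 isT.
Definition s2 : 'I_3 := @Ordinal 3 1 isT.
Definition s3 : 'I_3 := @Ordinal 3 2 isT.

(* Group words: (i, false) stands for sigma_i and (i, true) for its inverse.  *)
Definition letter : Type := 'I_3 * bool.
Definition gword : Type := seq letter.
Definition inv_letter (l : letter) : letter := (l.1, ~~ l.2).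
Definition pos_gword (w : seq 'I_3) : gword := [seq (i, false) | i <- w].

Variant artin_rel : seq 'I_3 -> seq 'I_3 -> Prop :=
| Artin12 : artin_rel [:: s1; s2; s1] [:: s2; s1; s2]
| Artin23 : artin_rel [:: s2; s3; s2] [:: s3; s2; s3]
| Artin13 : artin_rel [:: s1; s3] [:: s3; s1].

Inductive braid_equiv : gword -> gword -> Prop :=
| BraidRefl u : braid_equiv u u
| BraidSym u v : braid_equiv u v -> braid_equiv v u
| BraidTrans u v w : braid_equiv u v -> braid_equiv v w -> braid_equiv u w
| BraidCat u u' v v' :
    braid_equiv u u' -> braid_equiv v v' -> braid_equiv (u ++ v) (u' ++ v')
| BraidInv l : braid_equiv [:: l; inv_letter l] [::]
| BraidArtin u v :
    artin_rel u v -> braid_equiv (pos_gword u) (pos_gword v).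

Definition braid_eq : rel gword := fun u v => `[< braid_equiv u v >].

Lemma braid_eq_refl : reflexive braid_eq.
Proof. by move=> u; apply/asboolP/BraidRefl. Qed.

Lemma braid_eq_sym : symmetric braid_eq.
Proof. by move=> u v; apply/asboolP/asboolP => /BraidSym. Qed.

Lemma braid_eq_trans : transitive braid_eq.
Proof.
by move=> v u w /asboolP uv /asboolP vw; apply/asboolP/(BraidTrans uv vw).
Qed.

Canonical braid_eq_equiv :=
  EquivRel braid_eq braid_eq_refl braid_eq_sym braid_eq_trans.

Definition B4 : Type := {eq_quot braid_eq}.
HB.instance Definition _ : EqQuotient _ braid_eq B4 := EqQuotient.on B4.
HB.instance Definition _ := Choice.on B4.

Lemma braid_piP u v : braid_equiv u v <-> \pi_B4 u = \pi_B4 v.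
Proof. by split=> [h|/eqmodP/asboolP//]; apply/eqmodP/asboolP. Qed.

Definition inv_gword (w : gword) : gword := rev (map inv_letter w).

Definition braid_one : B4 := \pi_B4 [::].
Definition braid_inv (x : B4) : B4 := \pi_B4 (inv_gword (repr x)).
Definition braid_mul (x y : B4) : B4 := \pi_B4 (repr x ++ repr y).

Lemma repr_pi u : braid_equiv (repr (\pi_B4 u)) u.
Proof. by apply/braid_piP; rewrite reprK. Qed.

Lemma pi_cat u v : \pi_B4 (u ++ v) = braid_mul (\pi_B4 u) (\pi_B4 v).
Proof. by apply/braid_piP/BraidSym/BraidCat; apply: repr_pi. Qed.

Lemma inv_letterK : involutive inv_letter.
Proof. by case=> i b; rewrite /inv_letter /= negbK. Qed.

Lemma inv_gwordK : involutive inv_gword.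
Proof. by move=> w; rewrite /inv_gword map_rev revK (mapK inv_letterK). Qed.

Lemma inv_gwordV w : braid_equiv (w ++ inv_gword w) [::].
Proof.
elim: w => [|l w IHw]; first exact: BraidRefl.
rewrite /inv_gword /= rev_cons -cats1 catA -/(inv_gword w).
apply: BraidTrans (BraidInv l).
have h := BraidCat IHw (BraidRefl [:: inv_letter l]).
exact: BraidCat (BraidRefl [:: l]) h.
Qed.

Lemma braid_mulA : associative braid_mul.
Proof.
elim/quotW=> u; elim/quotW=> v; elim/quotW=> w.
by rewrite -(pi_cat v w) -(pi_cat u v) -(pi_cat u) -pi_cat catA.
Qed.

Lemma braid_mul1 : left_id braid_one braid_mul.
Proof. by move=> x; rewrite -[x]reprK -pi_cat. Qed.

Lemma braid_mulr1 : right_id braid_one braid_mul.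
Proof. by move=> x; rewrite -[x]reprK -pi_cat cats0. Qed.

Lemma braid_mulrV : right_inverse braid_one braid_inv braid_mul.
Proof.
move=> x; rewrite -{1}[x]reprK -pi_cat.
by apply/braid_piP/inv_gwordV.
Qed.

Lemma braid_mulV : left_inverse braid_one braid_inv braid_mul.
Proof.
move=> x; rewrite -{2}[x]reprK -pi_cat -{2}[repr x]inv_gwordK.
by apply/braid_piP/inv_gwordV.
Qed.

HB.instance Definition _ := isGroup.Build B4
  braid_mulA braid_mul1 braid_mulr1 braid_mulV braid_mulrV.

Definition sigma (i : 'I_3) : B4 := \pi_B4 [:: (i, false)].

Lemma sigma_prod (w : seq 'I_3) :
  \prod_(i <- w) sigma i = \pi_B4 (pos_gword w).
Proof.
elim: w => [|i w IHw]; first by rewrite big_nil.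
by rewrite big_cons IHw -[LHS]/(braid_mul _ _) -pi_cat.
Qed.

Lemma sigma_artin u v :
  artin_rel u v -> \prod_(i <- u) sigma i = \prod_(i <- v) sigma i.
Proof. by move=> uv; rewrite !sigma_prod; apply/braid_piP/BraidArtin. Qed.

Definition expansion (w : seq 'I_3) (x : B4) : Prop :=
  x = \prod_(i <- w) sigma i.

Definition positive (x : B4) : Prop := exists w, expansion w x.

Definition Delta : B4 :=
  (sigma s1 * sigma s2 * sigma s3) * (sigma s1 * sigma s2) * sigma s1.

Definition Delta_indivisible (x : B4) : Prop :=
  forall y : B4, positive y -> x <> Delta * y.

Local Close Scope group_scope.

Definition minimal_expansion (w : seq 'I_3) (x : B4) : Prop :=
  expansion w x /\
  forall v, expansion v x -> ((w : seqlexi 'I_3) <= (v : seqlexi 'I_3))%O.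

(* The exponents a_i, b_i, c_i are indexed by 1 <= i <= n; the values of the  *)
(* functions a, b, c elsewhere are immaterial.                                *)
Definition block_word (n : nat) (a b c : nat -> nat) : seq 'I_3 :=
  \big[cat/[::]]_(1 <= i < n.+1)
     (nseq (a i) s1 ++ nseq (b i) s3 ++ nseq (c i) s2).

Definition minimal_form (x : B4) (n : nat) (a b c : nat -> nat) : Prop :=
  [/\ minimal_expansion (block_word n a b c) x,
      forall i, 2 <= i <= n -> 0 < a i + b i
    & forall i, 1 <= i < n -> 0 < c i].

Definition normal_braid (x : B4) : Prop :=
  exists n (a b c : nat -> nat), minimal_form x n a b c /\
  forall p, 1 <= p < n ->
  [/\ a p = 0 -> b p = 1 -> c p <> 1 /\ c p <> 2,
      2 <= p -> a p = 0 -> b p = 1 -> c p <= a p.-1 + 1 -> c p.-1 <> 1,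
      0 < b p -> b p + 1 <= a p -> c p = 1 -> a p.+1 <> 2
    & a p = 1 -> b p = 1 -> c p = 1 -> a p.+1 <> 2].

Local Open Scope ring_scope.

Definition mx3 (R : Type) (x00 x01 x02 x10 x11 x12 x20 x21 x22 : R) :
    'M[R]_3 :=
  \matrix_(i, j) nth x00 (nth [::] [:: [:: x00; x01; x02];
                                       [:: x10; x11; x12];
                                       [:: x20; x21; x22]] i) j.

(* Here q is the indeterminate 'X of {poly int}.                              *)
Definition burau_gen (i : 'I_3) : 'M[{poly int}]_3 :=
  if i == s1 then mx3 'X  0  0
                    (-'X) 1  0
                      0   0  1
  else if i == s2 then mx3 1   1  0
                           0  'X  0
                           0 (-'X) 1
  else mx3 1 0  0
           0 1  1
           0 0 'X.

(* Z[q, q^-1] is regarded as a subring of Frac(Z[q]); burau_laurent below     *)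
(* shows that the entries of burau x do belong to it.                         *)
Notation fracX := {fraction {poly int}}.
Notation tofracX := (@FracField.tofrac {poly int}).

Definition burau_letter (l : letter) : 'M[fracX]_3 :=
  let g := map_mx tofracX (burau_gen l.1) in if l.2 then g^-1 else g.

Definition burau_gword (w : gword) : 'M[fracX]_3 := \prod_(l <- w) burau_letter l.

Definition burau (x : B4) : 'M[fracX]_3 := burau_gword (repr x).

Lemma ord3P (P : 'I_3 -> Prop) : P s1 -> P s2 -> P s3 -> forall i, P i.
Proof.
move=> h1 h2 h3 [[|[|[|//]]] hi].
- by rewrite (_ : Ordinal hi = s1) //; apply: val_inj.
- by rewrite (_ : Ordinal hi = s2) //; apply: val_inj.
- by rewrite (_ : Ordinal hi = s3) //; apply: val_inj.
Qed.

Lemma mx3M (R : pzRingType) (a b c d e f g h k a' b' c' d' e' f' g' h' k' : R) :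
  mx3 a b c d e f g h k *m mx3 a' b' c' d' e' f' g' h' k' =
  mx3 (a * a' + (b * d' + c * g')) (a * b' + (b * e' + c * h'))
      (a * c' + (b * f' + c * k')) (d * a' + (e * d' + f * g'))
      (d * b' + (e * e' + f * h')) (d * c' + (e * f' + f * k'))
      (g * a' + (h * d' + k * g')) (g * b' + (h * e' + k * h'))
      (g * c' + (h * f' + k * k')).
Proof.
apply/matrixP; do 2 apply: ord3P;
  by rewrite !mxE !big_ord_recl big_ord0 addr0 !mxE.
Qed.

Lemma mx3_scalar (R : pzRingType) (a : R) : mx3 a 0 0 0 a 0 0 0 a = a%:M.
Proof. by apply/matrixP; do 2 apply: ord3P; rewrite !mxE. Qed.

Lemma burau_gen_artin u v : artin_rel u v ->
  \prod_(i <- u) burau_gen i = \prod_(i <- v) burau_gen i.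
Proof.
case; rewrite !big_cons !big_nil !mulr1 /burau_gen /= -!mulmxE !mx3M;
  by congr (mx3 _ _ _ _ _ _ _ _ _); ring.
Qed.

(* X times the inverse of burau_gen i. *)
Definition burau_adj (i : 'I_3) : 'M[{poly int}]_3 :=
  if i == s1 then mx3 1   0  0
                     'X  'X  0
                      0   0 'X
  else if i == s2 then mx3 'X (-1)  0
                            0   1   0
                            0  'X  'X
  else mx3 'X  0  0
            0 'X (-1)
            0  0  1.

Lemma burau_gen_adj i : burau_gen i *m burau_adj i = 'X%:M.
Proof.
by rewrite -mx3_scalar; elim/ord3P: i; rewrite /burau_gen /burau_adj /= mx3M;
  congr (mx3 _ _ _ _ _ _ _ _ _); ring.
Qed.

Lemma tofracX_neq0 : tofracX 'X != 0.
Proof. by rewrite tofrac_eq0 polyX_eq0. Qed.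

Lemma burau_gen_invE i :
  map_mx tofracX (burau_gen i) *m
    ((tofracX 'X)^-1 *: map_mx tofracX (burau_adj i)) = 1%:M.
Proof.
rewrite -scalemxAr -map_mxM burau_gen_adj map_scalar_mx scale_scalar_mx.
by rewrite mulVf ?tofracX_neq0.
Qed.

Lemma burau_gen_unit i : map_mx tofracX (burau_gen i) \is a GRing.unit.
Proof.
apply/unitrP; exists ((tofracX 'X)^-1 *: map_mx tofracX (burau_adj i)).
by rewrite -!mulmxE; split; [apply: mulmx1C|]; apply: burau_gen_invE.
Qed.

Lemma burau_gen_inv i : (map_mx tofracX (burau_gen i))^-1 =
  (tofracX 'X)^-1 *: map_mx tofracX (burau_adj i).
Proof.
apply: (mulrI (burau_gen_unit i)); rewrite divrr ?burau_gen_unit //.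
by rewrite -mulmxE burau_gen_invE.
Qed.

Lemma burau_gword_pos w :
  burau_gword (pos_gword w) = map_mx tofracX (\prod_(i <- w) burau_gen i).
Proof.
by rewrite /burau_gword big_map (rmorph_prod (map_mx tofracX)).
Qed.

Lemma burau_gword_equiv u v :
  braid_equiv u v -> burau_gword u = burau_gword v.
Proof.
elim=> {u v} [//|u v _ -> //|u v w _ -> _ -> //|u u' v v' _ IHu _ IHv|[i b]|u v].
- by rewrite /burau_gword !big_cat /= -!/(burau_gword _) IHu IHv.
- rewrite /burau_gword !big_cons !big_nil mulr1 /burau_letter /=.
  by case: b; rewrite /= ?mulVr ?divrr ?burau_gen_unit.
- by move=> /burau_gen_artin uv; rewrite !burau_gword_pos uv.
Qed.

Lemma burau_pi w : burau (\pi_B4 w) = burau_gword w.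
Proof. exact/burau_gword_equiv/repr_pi. Qed.

Lemma burau_sigma i : burau (sigma i) = map_mx tofracX (burau_gen i).
Proof. by rewrite burau_pi /burau_gword big_cons big_nil mulr1. Qed.

Lemma burau1 : burau 1%g = 1.
Proof. by rewrite burau_pi /burau_gword big_nil. Qed.

Lemma burauM x y : burau (x * y)%g = burau x * burau y.
Proof. by rewrite -[LHS]/(burau (braid_mul x y)) burau_pi /burau_gword big_cat. Qed.

Lemma burau_unit x : burau x \is a GRing.unit.
Proof.
apply/unitrP; exists (burau x^-1%g).
by rewrite -!burauM mulVg mulgV burau1.
Qed.

Lemma burau_laurent x : exists k (M : 'M[{poly int}]_3),
  burau x = (tofracX 'X) ^- k *: map_mx tofracX M.
Proof.
rewrite /burau; elim: (repr x) => [|[i b] w [k [M IHw]]].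
  exists 0%N, 1; rewrite expr0 invr1 scale1r rmorph1.
  by rewrite /burau_gword big_nil.
rewrite /burau_gword big_cons -/(burau_gword w) IHw /burau_letter /=.
case: b; last first.
  exists k, (burau_gen i * M); rewrite rmorphM /=.
  by rewrite -[LHS]scalemxAr.
exists k.+1, (burau_adj i * M); rewrite rmorphM /= burau_gen_inv.
by rewrite -[LHS]scalemxAr -[X in _ *: X]scalemxAl scalerA exprSr invfM mulrC.
Qed.

Lemma burau_positive x : positive x ->
  exists M : 'M[{poly int}]_3, burau x = map_mx tofracX M.
Proof.
case=> w ->; exists (\prod_(i <- w) burau_gen i).
by rewrite sigma_prod burau_pi burau_gword_pos.
Qed.

(* Main.v *)
Require Import Defs.
From mathcomp Require Import all_boot all_order all_algebra.
From mathcomp Require Import ring zify.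

Set Implicit Arguments.
Unset Strict Implicit.
Unset Printing Implicit Defensive.

Import Order.TTheory GRing.Theory.
Local Open Scope ring_scope.

(** A row (x, y, z) of the Burau matrix evolves by right multiplication, one
    syllable sigma_1^a sigma_3^b sigma_2^c at a time, and the leading terms of
    its entries can be followed explicitly.  Generically y dominates after each
    syllable; the only cancellations of leading terms come from ties between x
    and y after a syllable with c = 1, and these are controlled by the normality
    conditions and by factors such as 212, 3 2^k 3 2 or 3 2 1^k 3, which cannot
    occur in a lexicographically minimal word.  Leading coefficients only change
    by signs and factors 2, hence stay prime to t.  A row can cancel down to a
    single monomial entry, so the row to follow is chosen from the first
    syllables of the word.  For one family of prefixes, 1^a 2 (1 3 2 2)^k,
    two rows are monomial multiples of (1, 1, 0) and (0, -q, 1), which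
    1 3 2 2 exchanges, and all three rows have to be followed until the word
    leaves the family. *)

(** * Geometric sums and leading terms of integer polynomials *)

Definition geo (n : nat) : {poly int} := \sum_(i < n) 'X^i.

Lemma geo0 : geo 0 = 0.
Proof. by rewrite /geo big_ord0. Qed.

Lemma geoSr n : geo n.+1 = geo n + 'X^n.
Proof. by rewrite /geo big_ord_recr. Qed.

Lemma geoSl n : geo n.+1 = 1 + 'X * geo n.
Proof.
rewrite /geo big_ord_recl expr0 mulr_sumr; congr (_ + _).
by apply: eq_bigr => i _; rewrite -exprS.
Qed.

Lemma geo1 : geo 1 = 1.
Proof. by rewrite geoSr geo0 add0r expr0. Qed.

(* The coefficient c may vanish: [top k 0 p] says that p has degree below k.   *)
(* Degree gaps are expressed by multiplying by 'X (as in [top k 0 ('X * z)])   *)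
(* rather than by subtracting from k, so that z = 0 is not an exception.       *)
Definition top (k : nat) (c : int) (p : {poly int}) : Prop :=
  (size p <= k.+1)%N /\ p`_k = c.

Lemma top_lt k c p j : top k c p -> (k < j)%N -> top j 0 p.
Proof.
move=> [sp _] kj; split; first by apply: leq_trans sp _; apply: leqW.
by rewrite nth_default // (leq_trans sp).
Qed.

Lemma top_le0 k p j : top k 0 p -> (k <= j)%N -> top j 0 p.
Proof.
by move=> hp; rewrite leq_eqVlt => /predU1P [<- //|]; apply: top_lt hp.
Qed.

Lemma top0 k : top k 0 0.
Proof. by split; rewrite ?size_poly0 ?coef0. Qed.

Lemma topD k c d p r : top k c p -> top k d r -> top k (c + d) (p + r).
Proof.
move=> [sp cp] [sr cr]; split; last by rewrite coefD cp cr.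
by rewrite (leq_trans (size_polyD _ _)) // geq_max sp.
Qed.

Lemma topN k c p : top k c p -> top k (- c) (- p).
Proof. by move=> [sp cp]; split; rewrite ?size_polyN // coefN cp. Qed.

Lemma topB k c d p r : top k c p -> top k d r -> top k (c - d) (p - r).
Proof. by move=> hp hr; apply: topD hp (topN hr). Qed.

Lemma topM k j c d p r :
  top k c p -> top j d r -> top (k + j) (c * d) (p * r).
Proof.
move=> [sp <-] [sr <-]; split.
  have h := size_polyMleq p r; rewrite (leq_trans h) // -subn1 leq_subLR.
  by rewrite (leq_trans (leq_add sp sr)) // addSn addnS add1n.
rewrite coefM (bigD1 (Ordinal (leq_addr j k : (k < (k + j).+1)%N))) //=.
rewrite addKn big1 ?addr0 // => -[i Hi] /eqP ne /=.
have {}ne : i <> k by move=> e; apply: ne; apply: val_inj.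
case: (ltnP i k) => ik; first by rewrite [r`__]nth_default ?mulr0 // (leq_trans sr) //; lia.
by rewrite nth_default ?mul0r // (leq_trans sp) //; lia.
Qed.

Lemma topXn n : top n 1 'X^n.
Proof. by split; rewrite ?size_polyXn // coefXn eqxx. Qed.

Lemma topX : top 1 1 'X.
Proof. by split; rewrite ?size_polyX // coefX. Qed.

Lemma top1 : top 0 1 1.
Proof. by split; rewrite ?size_poly1 // coef1. Qed.

Lemma top_geo n : top n 1 (geo n.+1).
Proof.
elim: n => [|n IHn]; first by rewrite geo1; apply: top1.
rewrite geoSr -[1]add0r; apply: topD; last exact: topXn.
exact: top_lt IHn _.
Qed.

Lemma top_eq k c p j d r : top k c p -> k = j -> c = d -> p = r -> top j d r.
Proof. by move=> ? <- <- <-. Qed.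

Lemma topXM k c p : top k c p -> top k.+1 c ('X * p).
Proof. by move=> hp; apply: top_eq (topM topX hp) _ _ _ => //; rewrite mul1r. Qed.

Lemma top_lead k c p : top k c p -> c != 0 -> p != 0 /\ lead_coef p = c.
Proof.
move=> [sp cp] c0.
have kp : (k < size p)%N.
  by rewrite ltnNge; apply: contra c0 => h; rewrite -cp nth_default.
have ep : size p = k.+1 by apply/eqP; rewrite eqn_leq sp.
by split; rewrite -?size_poly_gt0 ?ep // lead_coefE ep.
Qed.

(** * Leading terms of a row under one syllable *)

Definition vec : Type := {poly int} * {poly int} * {poly int}.

Definition block (a b c : nat) (v : vec) : vec :=
  let: (x, y, z) := v in
  let x' := 'X^a * x - 'X * geo a * y in
  let z' := 'X^b * z + geo b * y in
  (x', 'X^c * y + geo c * (x' - 'X * z'), z').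

Lemma top_x k cx cy x y a : (0 < a)%N -> top k cx x -> top k cy y ->
  top (k + a) (cx - cy) ('X^a * x - 'X * geo a * y).
Proof.
case: a => // a _ hx hy.
apply: top_eq (topB (topM (topXn a.+1) hx) (topM (topXM (top_geo a)) hy)) _ _ _ => //.
  by rewrite addnC.
by rewrite !mul1r.
Qed.

Lemma top_z k cz cy z y b : (0 < b)%N -> top k cz ('X * z) -> top k cy y ->
  top (k + b) (cz + cy) ('X * ('X^b * z + geo b * y)).
Proof.
case: b => // b _ hz hy.
apply: top_eq (topD (topM (topXn b.+1) hz) (topM (topXM (top_geo b)) hy)) _ _ _.
- by rewrite addnC.
- by rewrite !mul1r.
- by ring.
Qed.

(** [u] stands for x' - q z'. Two degrees above [y], its multiple by [geo c] outweighs q^c y; only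
    one degree above, as in [top_y_eq], the two terms meet and add. *)
Lemma top_y k K cy d y u c : (0 < c)%N -> (k.+1 < K)%N ->
  top k cy y -> top K d u -> top (K + c.-1) d ('X^c * y + geo c * u).
Proof.
case: c => // c _ kK hy hu /=; rewrite -[d]add0r.
apply: topD; first by apply: top_lt (topM (topXn c.+1) hy) _; lia.
by apply: top_eq (topM (top_geo c) hu) _ _ _; rewrite ?mul1r // addnC.
Qed.

Lemma top_y_eq k cy d y u c : (0 < c)%N ->
  top k cy y -> top k.+1 d u -> top (k + c) (cy + d) ('X^c * y + geo c * u).
Proof.
case: c => // c _ hy hu.
apply: topD; first by apply: top_eq (topM (topXn c.+1) hy) _ _ _; rewrite ?mul1r // addnC.
by apply: top_eq (topM (top_geo c) hu) _ _ _; rewrite ?mul1r //; lia.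
Qed.

Lemma top_yB k cx cy x y z b c : (1 < b)%N -> (0 < c)%N ->
  top k cx x -> top k cy y -> top k 0 ('X * z) ->
  top (k + b + c.-1) (- cy) ('X^c * y + geo c * (x - 'X * ('X^b * z + geo b * y))).
Proof.
move=> b1 c0 hx hy hz; have b0 : (0 < b)%N by exact: ltnW.
apply: (top_y c0 _ hy); first lia.
have hx' : top (k + b) 0 x by apply: top_lt hx _; lia.
by apply: top_eq (topB hx' (top_z b0 hz hy)) _ _ _; rewrite ?sub0r ?add0r.
Qed.

(** x' leads with -cy in degree k + a, and q z' with cy in degree k + b. The larger exponent wins;
    for a = b they reinforce to -2 cy, from which q^c y takes back one cy if the common exponent is
    1. *)
Lemma top_yC k cy x y z a b c : (0 < a)%N -> (0 < b)%N -> (0 < c)%N ->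
  top k 0 x -> top k cy y -> top k 0 ('X * z) ->
  top (k + maxn a b + c.-1)
    (if a == b then if a == 1%N then - cy else - (cy + cy) else - cy)
    ('X^c * y + geo c * ('X^a * x - 'X * geo a * y - 'X * ('X^b * z + geo b * y))).
Proof.
move=> a0 b0 c0 hx hy hz.
have := top_x a0 hx hy; rewrite sub0r; set x' := 'X^a * x - _ => hx'.
have := top_z b0 hz hy; rewrite add0r; set z' := 'X^b * z + _ => hz'.
case: (ltngtP a b) => ab.
- apply: (top_y c0 _ hy); first lia.
  by rewrite -[- cy]add0r; apply: topB => //; apply: top_lt hx' _; lia.
- apply: (top_y c0 _ hy); first lia.
  by rewrite -[- cy]subr0; apply: topB => //; apply: top_lt hz' _; lia.
- rewrite ab in hx' *.
  have h : top (k + b) (- (cy + cy)) (x' - 'X * z').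
    by apply: top_eq (topB hx' hz') _ _ _ => //; ring.
  case: eqP => [b1|nb1]; last by apply: (top_y c0 _ hy) => //; lia.
  rewrite b1 addn1 in h *.
  by apply: top_eq (top_y_eq c0 hy h) _ _ _ => //; [lia | ring].
Qed.

Lemma top_mulX_lead k c p : top k c ('X * p) -> c != 0 -> p != 0 /\ lead_coef p = c.
Proof.
move=> hp c0; have [p0 lp] := top_lead hp c0.
split; first by apply: contraNneq p0 => ->; rewrite mulr0.
by rewrite -lp lead_coefM lead_coefX mul1r.
Qed.

(* A field red_w records that a factor of the shape w, with arbitrary powers   *)
(* inside, does not occur, and red_Delta that 1^a 2 1 3 2 1, which equals      *)
(* Delta 3^(a-1), is not a prefix; red_n1 to red_n4 are the clauses of         *)
(* normality, the first one combined with c p > 0.                             *)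
Record reduced (n : nat) (a b c : nat -> nat) : Prop := Reduced {
  red_ab : forall p, (1 < p <= n)%N -> (0 < a p + b p)%N;
  red_c : forall p, (0 < p < n)%N -> (0 < c p)%N;
  red_212 : forall p, (0 < p < n)%N ->
    b p.+1 = 0%N -> (0 < c p.+1)%N -> (1 < a p.+1)%N;
  red_2121 : forall p, (0 < p)%N -> (p.+1 < n)%N ->
    b p.+1 = 0%N -> c p.+1 = 1%N -> a p.+2 = 0%N;
  red_3213 : forall p, (0 < p < n)%N ->
    (0 < b p)%N -> c p = 1%N -> b p.+1 = 0%N;
  red_3232 : forall p, (0 < p < n)%N ->
    (0 < b p)%N -> a p.+1 = 0%N -> b p.+1 = 1%N -> c p.+1 = 0%N;
  red_321321 : forall p, (0 < p)%N -> (p.+1 < n)%N ->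
    (0 < b p)%N -> a p.+1 = 1%N -> b p.+1 = 1%N -> c p.+1 = 1%N -> a p.+2 = 0%N;
  red_321232 : forall p, (0 < p)%N -> (p.+1 < n)%N ->
    (0 < b p)%N -> c p = 1%N -> b p.+1 = 0%N -> c p.+1 = 1%N ->
    a p.+2 = 0%N -> b p.+2 = 1%N -> c p.+2 = 0%N;
  red_Delta : (2 < n)%N -> (0 < a 1)%N -> b 1 = 0%N -> c 1 = 1%N ->
    a 2 = 1%N -> b 2 = 1%N -> c 2 = 1%N -> a 3 = 0%N;
  red_n1 : forall p, (0 < p < n)%N -> a p = 0%N -> b p = 1%N -> (2 < c p)%N;
  red_n2 : forall p, (0 < p)%N -> (p.+1 < n)%N ->
    c p = 1%N -> a p.+1 = 0%N -> b p.+1 = 1%N -> (a p + 1 < c p.+1)%N;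
  red_n3 : forall p, (0 < p < n)%N ->
    (0 < b p)%N -> (b p < a p)%N -> c p = 1%N -> a p.+1 <> 2%N;
  red_n4 : forall p, (0 < p < n)%N ->
    a p = 1%N -> b p = 1%N -> c p = 1%N -> a p.+1 <> 2%N }.

(** * States of a row between syllables *)

Section RowStates.

Variables (t : nat) (n : nat) (a b c : nat -> nat).
Hypotheses (t_prime : prime t) (t_odd : t <> 2%N) (red : reduced n a b c).

Definition unitc (d : int) : bool := ~~ (t %| d)%Z.

Definition good (p : {poly int}) : bool := (p != 0) && unitc (lead_coef p).

Definition good_row (v : vec) : bool :=
  let: (x, y, z) := v in
  [|| good x && good y, good x && good z | good y && good z].

Lemma unitc_neq0 d : unitc d -> d != 0.
Proof. by apply: contraNneq => ->; rewrite dvdz0. Qed.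

Lemma unitcN d : unitc (- d) = unitc d.
Proof. by rewrite /unitc !dvdzE abszN. Qed.

(** Oddness of [t] enters here: coefficients double when two equal leading terms meet. *)
Lemma unitc2 d : unitc (d + d) = unitc d.
Proof.
rewrite /unitc !dvdzE -mulr2n -mulr_natl abszM Euclid_dvdM //.
suff -> : (t %| `|(2%:R : int)|)%N = false by [].
apply/negP => /dvdn_leq t2.
by have := prime_gt1 t_prime; have : (t <= 2)%N := t2 isT; lia.
Qed.

Lemma unitc1 : unitc 1.
Proof. by rewrite /unitc dvdzE dvdn1 absz_nat; apply: contraL t_prime => /eqP ->. Qed.

Lemma top_good k d p : top k d p -> unitc d -> good p.
Proof.
by move=> hp ud; have [p0 lp] := top_lead hp (unitc_neq0 ud); rewrite /good p0 lp.
Qed.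

Lemma top_mulX_good k d p : top k d ('X * p) -> unitc d -> good p.
Proof.
by move=> hp ud; have [p0 lp] := top_mulX_lead hp (unitc_neq0 ud); rewrite /good p0 lp.
Qed.

(* The states [st_*] describe a row after the p-th syllable, 1 <= p < n.  Here *)
(* y dominates.  The two extra clauses are what the next syllables 1 3 2 and   *)
(* 3 2^c require: z lags by two more degrees, and a final 3, 3 2 or 3 2 2      *)
(* leaves x and z good.                                                        *)
Definition st_dominant (p : nat) (v : vec) : Prop := let: (x, y, z) := v in
  exists k d, [/\ top k d y, unitc d, top k 0 x & top k 0 ('X * z)] /\
    ((0 < b p)%N \/ top k 0 ('X * ('X * z))) /\
    (p.+1 = n -> a p.+1 = 0%N -> b p = 0%N -> good x).

(* After 3 2, hence before a power of 1: the leading terms of x and y may be   *)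
(* equal (j = 1), in which case the first sigma_1 cancels them and the         *)
(* polynomial below carries what remains; otherwise x - y does (j = 0).        *)
Definition st_pending (p : nat) (v : vec) : Prop := let: (x, y, z) := v in
  [/\ (0 < b p)%N, c p = 1%N & good z] /\
  exists k d e, [/\ top k d y, unitc d & top k e ('X * z)] /\
    ((1 < a p.+1)%N -> exists j f, [/\ (j < 2)%N, (j.+1 < a p.+1)%N, unitc f
        & top k f ('X^j * (x - y) - geo j * y)]).

(* After 1^a 2, hence before a power of 3: x and y may have equal leading      *)
(* terms, which cancel if the next syllable is 3 2^c; the second clause names  *)
(* the term that takes over.                                                   *)
Definition st_tied (p : nat) (v : vec) : Prop := let: (x, y, z) := v in
  [/\ a p.+1 = 0%N & good x] /\
  exists k d e, [/\ top k d y, unitc d, top k e x & top k 0 ('X * z)] /\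
    ((p.+1 < n)%N -> b p.+1 = 1%N -> exists j f,
      [/\ (k + 3 <= j + c p.+1)%N, unitc f & top j f (x - y - 'X * ('X * z))]).

(* Reached only from [st_twin], through 1 1 2 when 3 2^c follows.              *)
Definition st_corner (p : nat) (v : vec) : Prop := let: (x, y, z) := v in
  [/\ a p.+1 = 0%N, b p.+1 = 1%N & (p.+1 < n)%N] /\
  [/\ y = 0, z = 0 & exists k d, top k d x /\ unitc d].

Definition st (p : nat) (v : vec) : Prop :=
  [\/ st_dominant p v, st_pending p v, st_tied p v | st_corner p v].

(** A syllable without sigma_3, [x] being the entry after the powers of sigma_1. If c > 1, y gains c
    - 1 degrees on x and dominates; if c = 1 they tie, and the polynomial in the last hypothesis is
    minus the x - y - q^2 z of [st_tied]. *)
Lemma st_blockA p k K d e f x y z : (0 < p < n)%N ->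
  top k d y -> top K f x -> unitc f -> top k e ('X * z) -> (k.+1 < K)%N ->
  b p = 0%N -> (0 < c p)%N ->
  (c p = 1%N -> a p.+1 = 0%N /\
     ((p.+1 < n)%N -> b p.+1 = 1%N -> exists j f',
      [/\ (K + 3 <= j + c p.+1)%N, unitc f'
        & top j f' ('X * ('X * z) + 'X * y - 'X * z)])) ->
  st p (x, 'X^(c p) * y + geo (c p) * (x - 'X * z), z).
Proof.
move=> p_n hy hx uf hz kK bp cp hO.
have hu : top K f (x - 'X * z).
  by rewrite -[f]subr0; apply: topB => //; apply: (top_lt hz); lia.
have hy' := top_y cp kK hy hu.
case: (posnP (c p).-1) => c1; last first.
  apply: Or41; exists (K + (c p).-1)%N, f; split; last split.
  - by split=> //; [apply: (top_lt hx) | apply: (top_lt hz)]; lia.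
  - by right; apply: (top_lt (topXM hz)); lia.
  - by move=> _ _ _; apply: top_good hx uf.
have {}cp : c p = 1%N by lia.
have [ap info] := hO cp; rewrite cp /= addn0 in hy' *.
apply: Or43; split; first by split=> //; apply: top_good hx uf.
exists K, f, f; split; first by split=> //; apply: (top_lt hz); lia.
move=> pn bp1; have [j [f' [? uf' hf']]] := info pn bp1.
exists j, (- f'); split; rewrite ?unitcN //.
apply: top_eq (topN hf') _ _ _ => //; rewrite expr1 geo1; ring.
Qed.

Lemma st_blockB p k d e x y z : (1 < b p)%N -> (0 < c p)%N ->
  top k e x -> top k d y -> unitc d -> top k 0 ('X * z) ->
  st p (block 0 (b p) (c p) (x, y, z)).
Proof.
move=> bp cp hx hy ud hz; rewrite /block expr0 geo0 mulr0 mul0r mul1r subr0.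
have bp0 : (0 < b p)%N by exact: ltnW.
have hy' := top_yB bp cp hx hy hz; have := top_z bp0 hz hy.
rewrite add0r; move: hy'; set z' := 'X^(b p) * z + _; set y' := 'X^(c p) * y + _.
move=> hy' hz'.
case: (posnP (c p).-1) => c1; last first.
  apply: Or41; exists (k + b p + (c p).-1)%N, (- d).
  split; last by split; [left | lia].
  by split; rewrite ?unitcN //; [apply: (top_lt hx) | apply: (top_lt hz')]; lia.
have {}cp : c p = 1%N by lia.
rewrite cp /= addn0 in hy'.
apply: Or42; split; first by split=> //; apply: top_mulX_good hz' ud.
exists (k + b p)%N, (- d), d; rewrite unitcN; split=> // ap.
(* x lags behind y', so nothing cancels in x - y' and j = 0. *)
exists 0%N, d; split=> //; rewrite expr0 mul1r geo0 mul0r subr0.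
apply: top_eq (topB (top_lt hx _) hy') _ _ _ => //; first lia.
by rewrite sub0r opprK.
Qed.

(** With a single sigma_3 the leading terms of q^c y and q geo(c) y cancel, so the new y is left to
    a hypothesis, supplied by [top_yB1] or [top_y_tied]. *)
Lemma st_blockB1 p k K d e f x y z : b p = 1%N -> (k.+1 < K)%N -> 
  top k e x -> top k d y -> top k 0 ('X * z) -> unitc f ->
  top K f ('X^(c p) * y + geo (c p) * (x - 'X * ('X * z + y))) ->
  st p (block 0 (b p) (c p) (x, y, z)).
Proof.
move=> bp kK hx hy hz uf.
rewrite /block bp expr0 expr1 geo0 geo1 mulr0 mul0r !mul1r subr0 => hy'.
apply: Or41; exists K, f; rewrite bp.
split; last by split; [left | lia].
split=> //; first by apply: (top_lt hx); lia.
rewrite mulrDr -[0]addr0; apply: topD; first by apply: (top_lt (topXM hz)); lia.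
by apply: (top_lt (topXM hy)); lia.
Qed.

(** The exponent of sigma_1 is a free [m] because a row (u, u, 0) spends one sigma_1 on killing x,
    see [block_uu]. *)
Lemma st_blockC p k d m x y z : (0 < m)%N -> (0 < b p)%N -> (0 < c p)%N ->
  top k d y -> unitc d -> top k 0 x -> top k 0 ('X * z) ->
  (c p = 1%N -> (b p < m)%N -> a p.+1 <> 2%N) ->
  (c p = 1%N -> m = 1%N -> b p = 1%N -> a p.+1 <> 2%N /\
    ((1 < a p.+1)%N -> top k 0 ('X * ('X * z)))) ->
  st p (block m (b p) (c p) (x, y, z)).
Proof.
move=> m0 bp cp hy ud hx hz n3 n4; rewrite /block.
have hy' := top_yC m0 bp cp hx hy hz.
have := top_x m0 hx hy; have := top_z bp hz hy; rewrite add0r sub0r.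
move: hy'; set f0 := (if _ then _ else _); have [f Ef] : exists f, f = f0 by exists f0.
rewrite -Ef => hy'; rewrite /f0 {f0} in Ef.
have uf : unitc f by rewrite Ef; case: (m == b p); case: (m == 1%N); rewrite unitcN ?unitc2.
move: hy'; set x' := 'X^m * x - _; set z' := 'X^(b p) * z + _.
set y' := 'X^(c p) * y + _ => hy' hz' hx'.
case: (posnP (c p).-1) => c1; last first.
  apply: Or41; exists (k + maxn m (b p) + (c p).-1)%N, f.
  split; last by split; [left | lia].
  by split=> //; [apply: (top_lt hx') | apply: (top_lt hz')]; lia.
have {}cp : c p = 1%N by lia.
rewrite cp /= addn0 in hy'.
have [K EK] : exists K, K = (k + maxn m (b p))%N by eexists.
rewrite -EK in hy'.
apply: Or42; split; first by split=> //; apply: top_mulX_good hz' ud.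
have [e he] : exists e, top K e ('X * z').
  case: (leqP m (b p)) => mb; first by exists d; apply: top_eq hz' _ _ _ => //; lia.
  by exists 0; apply: (top_lt hz'); lia.
exists K, f, e; split=> // ap.
have ey' : y' = 'X * y + x' - 'X * z' by rewrite /y' cp expr1 geo1; ring.
case: (ltngtP m (b p)) => mb.
- exists 0%N, d; split=> //; rewrite expr0 mul1r geo0 mul0r subr0.
  have hx0 : top K 0 x' by apply: (top_lt hx'); lia.
  apply: top_eq (topB hx0 hy') _ _ _ => //.
  have -> : f = - d by rewrite Ef (_ : (m == b p) = false) //; apply/eqP; lia.
  by rewrite sub0r opprK.
(* For m > b_p, x' and y' share the leading term -d q^K. The next sigma_1 cancels it, so j = 1 and
   a_{p+1} must not be 2. *)
- have ap2 := n3 cp mb.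
  have fE : f = - d by rewrite Ef (_ : (m == b p) = false) //; apply/eqP; lia.
  (* [g] is the coefficient of q(q z' - q y) in degree K: d if m = b_p + 1 and b_p > 1, which
     doubles the final coefficient, and 0 otherwise. *)
  have [g [gE hg]] : exists g, (g = 0 \/ g = d) /\
      top K g ('X * ('X * z' - 'X * y)).
    have h1 := topM (topXn (b p).+1) hz.
    have -> : 'X * ('X * z' - 'X * y) =
        'X^((b p).+1) * ('X * z) + 'X * 'X * 'X * (geo (b p).-1 * y).
      by rewrite /z' -(prednK bp) geoSl /= !exprS; ring.
    case: (ltnP 1 (b p)) => b1; last first.
      exists 0; split; first by left.
      rewrite (_ : b p = 1%N) in h1 *; last lia.
      rewrite geo0 mul0r mulr0 addr0; apply: (top_le0 _ (_ : (2 + k <= _)%N)); last lia.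
      by apply: top_eq h1 _ _ _; rewrite ?mulr0.
    have h2 := topM (topM (topM (topM topX topX) topX) (top_geo (b p).-2)) hy.
    rewrite (_ : (b p).-2.+1 = (b p).-1) in h2; last lia.
    have h : top (k + (b p).+1) d ('X^((b p).+1) * ('X * z) + 'X * 'X * 'X * (geo (b p).-1 * y)).
      apply: top_eq (topD (top_eq h1 _ _ _) h2) _ _ _; rewrite ?mulr0 ?add0r ?mul1r //; try lia.
      by rewrite -!mulrA.
    case: (ltnP (b p).+1 m) => m1.
      exists 0; split; first by left.
      by apply: (top_lt h); lia.
    exists d; split; first by right.
    by apply: top_eq h _ _ _ => //; lia.
  exists 1%N, (g + d); split=> //; first lia.
    by case: gE => ->; rewrite ?add0r ?unitc2.
  rewrite expr1 geo1 mul1r.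
  apply: top_eq (topB hg hy') _ _ _ => //; first by rewrite fE opprK.
  by rewrite [X in _ = 'X * (_ - X) - _]ey'; ring.
(* For m = b_p = 1, x' and y' tie again; for m = b_p > 1, y' leads with -2d against -d, so x' - y'
   already leads with d. *)
- case: (eqVneq m 1%N) => m1.
    have b1 : b p = 1%N by lia.
    have [ap2 hzz] := n4 cp m1 b1.
    have fE : f = - d by rewrite Ef -mb m1.
    exists 1%N, d; split=> //; first lia.
    rewrite expr1 geo1 mul1r.
    have hX : top K 0 ('X * ('X * ('X * z))).
      by apply: top_eq (topXM (hzz ap)) _ _ _ => //; rewrite EK b1 m1; lia.
    apply: top_eq (topB hX hy') _ _ _ => //; first by rewrite fE sub0r opprK.
    rewrite [X in _ = 'X * (_ - X) - _]ey' /z' b1 expr1 geo1; ring.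
  have fE : f = - (d + d) by rewrite Ef mb eqxx -mb (negPf m1).
  have hx'' : top K (- d) x' by apply: top_eq hx' _ _ _ => //; lia.
  exists 0%N, d; split=> //; rewrite expr0 mul1r geo0 mul0r subr0.
  by apply: top_eq (topB hx'' hy') _ _ _ => //; rewrite fE; ring.
Qed.

Lemma block_a0 l k x y z : block 0 l k (x, y, z) =
  let z' := 'X^l * z + geo l * y in (x, 'X^k * y + geo k * (x - 'X * z'), z').
Proof. by rewrite /block expr0 mul1r geo0 mulr0 mul0r subr0. Qed.

Lemma block_b0 m k x y z : block m 0 k (x, y, z) =
  let x' := 'X^m * x - 'X * geo m * y in (x', 'X^k * y + geo k * (x' - 'X * z), z).
Proof. by rewrite /block expr0 mul1r geo0 mul0r addr0. Qed.

Lemma block_c0 m l x y z : block m l 0 (x, y, z) =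
  ('X^m * x - 'X * geo m * y, y, 'X^l * z + geo l * y).
Proof. by rewrite /block expr0 mul1r geo0 mul0r addr0. Qed.

(** The top powers in q^m y - q geo(m) y cancel and leave -q geo(m-1) y; hence m > 1 and the
    stronger bound on z. *)
Lemma top_yB1 k d x y z m : (1 < m)%N -> top k 0 x -> top k d y ->
  top k 0 ('X * ('X * z)) ->
  top (k + m.-1) (- d) ('X^m * y + geo m * (x - 'X * ('X * z + y))).
Proof.
case: m => [|[|m]] // _ hx hy hz.
have h1 := topM (top_geo m.+1) (topB hx hz).
have h2 := topM (topXM (top_geo m)) hy.
apply: top_eq (topB h1 h2) _ _ _ => /=; first exact: addnC.
  by rewrite mulr0 mul1r sub0r.
rewrite (geoSr m.+1) (exprS _ m.+1); ring.
Qed.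

Lemma good_row_mid m l k x y z : (0 < m)%N -> (0 < l)%N -> (0 < k)%N ->
  forall j d, top j d y -> unitc d -> top j 0 x -> top j 0 ('X * z) ->
  good_row (block m l k (x, y, z)).
Proof.
move=> m0 l0 k0 j d hy ud hx hz.
have gy := top_yC m0 l0 k0 hx hy hz.
have {}gy := top_good gy.
have gz : good ('X^l * z + geo l * y).
  by apply: top_mulX_good (top_z l0 hz hy) _; rewrite add0r.
rewrite /block /good_row gz gy ?orbT //.
by case: (m == l); case: (m == 1%N); rewrite unitcN ?unitc2.
Qed.

(** * Passage of each state through an inner or a final syllable *)

Lemma step_dominant p v : (0 < p)%N -> (p.+1 < n)%N -> st_dominant p v ->
  st p.+1 (block (a p.+1) (b p.+1) (c p.+1) v).
Proof.
case: v => [[x y] z] p0 pn [k [d [[hy ud hx hz] [hzz _]]]].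
have pn' : (0 < p < n)%N by lia.
have cp : (0 < c p.+1)%N by apply: (red_c red); lia.
have ab : (0 < a p.+1 + b p.+1)%N by apply: (red_ab red); lia.
case: (posnP (a p.+1)) => ap; case: (posnP (b p.+1)) => bp; first lia.
- rewrite ap; case: (ltnP 1 (b p.+1)) => b1; first exact: (st_blockB b1 cp hx hy ud hz).
  have {}b1 : b p.+1 = 1%N by lia.
  (* If b_p > 0, the word would contain 3 2^k 3 2; so z lags by two degrees. *)
  have {}hzz : top k 0 ('X * ('X * z)).
    by case: hzz => // bp0; have := red_3232 red pn' bp0 ap b1; lia.
  have c2 : (2 < c p.+1)%N by apply: (red_n1 red) => //; lia.
  have hy' := top_yB1 (ltnW c2) hx hy hzz.
  by apply: (st_blockB1 b1 _ hx hy hz _ hy'); [lia | rewrite unitcN].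
- have a1 : (1 < a p.+1)%N by apply: (red_212 red).
  have := top_x ap hx hy; rewrite sub0r => hx'.
  rewrite bp block_b0 /=.
  apply: (st_blockA _ hy hx' _ hz) => //; [by rewrite unitcN | lia | ].
  move=> c1; split; first exact: (red_2121 red).
  (* Here x - y - q^2 z is led by -q y, so j = k + 1, and the inequality on j becomes c_{p+2} >
     a_{p+1} + 1. *)
  move=> pn2 b2; exists k.+1, d; split=> //.
    by have := red_n2 red (isT : (0 < p.+1)%N) pn2 c1 (red_2121 red p0 pn bp c1) b2; lia.
  have hz1 : top k.+1 0 ('X * z) by apply: (top_lt hz).
  by apply: top_eq (topB (topD (topXM hz) (topXM hy)) hz1) _ _ _; rewrite ?add0r ?subr0.
- apply: (st_blockC _ _ _ hy) => // c1.
    by move=> ba; apply: (red_n3 red) => //; lia.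
  move=> a1 b1; split; first by apply: (red_n4 red) => //; lia.
  by case: hzz => // bp0 a2; have := red_321321 red p0 pn bp0 a1 b1 c1; lia.
Qed.

Lemma fin_dominant p v : (0 < p)%N -> p.+1 = n -> st_dominant p v ->
  good_row (block (a p.+1) (b p.+1) (c p.+1) v).
Proof.
case: v => [[x y] z] p0 pn [k [d [[hy ud hx hz] [hzz gx]]]].
have pn' : (0 < p < n)%N by lia.
have ab : (0 < a p.+1 + b p.+1)%N by apply: (red_ab red); lia.
have gy := top_good hy ud.
have gz' : (0 < b p.+1)%N -> good ('X^(b p.+1) * z + geo (b p.+1) * y).
  by move=> b0; apply: top_mulX_good (top_z b0 hz hy) _; rewrite add0r.
have gx' : (0 < a p.+1)%N -> good ('X^(a p.+1) * x - 'X * geo (a p.+1) * y).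
  by move=> a0; apply: top_good (top_x a0 hx hy) _; rewrite sub0r unitcN.
case: (posnP (c p.+1)) => cp.
  rewrite cp block_c0 /good_row gy.
  case: (posnP (a p.+1)) => ap; last by rewrite gx'.
  by rewrite gz' ?orbT //; lia.
case: (posnP (a p.+1)) => ap; case: (posnP (b p.+1)) => bp; first lia.
- case: (ltnP 1 (b p.+1)) => b1.
    have gy' : good ('X^(c p.+1) * y +
        geo (c p.+1) * (x - 'X * ('X^(b p.+1) * z + geo (b p.+1) * y))).
      by apply: top_good (top_yB b1 cp hx hy hz) _; rewrite unitcN.
    by rewrite ap block_a0 /good_row /= gy' gz' ?orbT.
  (* A single sigma_3 can cancel the leading term of y, so x and z are used; [red_3232] gives b_p =
     0, which makes x good. *)
  rewrite ap block_a0 /good_row /= gz' //.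
  rewrite gx ?orbT //; case: (posnP (b p)) => // bp0.
  have b1' : b p.+1 = 1%N by lia.
  by have := red_3232 red pn' bp0 ap b1'; lia.
- have a1 : (1 < a p.+1)%N by apply: (red_212 red).
  rewrite bp block_b0 /= gx' //.
  have hx' := top_x ap hx hy.
  have hu : top (k + a p.+1) (0 - d) ('X^(a p.+1) * x - 'X * geo (a p.+1) * y - 'X * z).
    by rewrite -[0 - d]subr0; apply: topB => //; apply: (top_lt hz); lia.
  rewrite (top_good (top_y cp _ hy hu)) //; first lia.
  by rewrite sub0r unitcN.
- exact: (good_row_mid ap bp cp hy ud).
Qed.

(** With D = q^j (x - y) - geo(j) y, the new x is q^(m+2) D - q geo(m+1) y: D absorbs the
    cancellation, and the other m + 2 copies of sigma_1 lift it above the remainder. *)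
Lemma top_x_pending k d f x y j m : (j < 2)%N -> top k d y ->
  top k f ('X^j * (x - y) - geo j * y) ->
  top (k + m.+2) f ('X^(m.+2 + j) * x - 'X * geo (m.+2 + j) * y).
Proof.
move=> j2 hy hD.
have hy' : top (k + m.+2) 0 ('X * (geo m.+1 * y)).
  by apply: (top_lt (topXM (topM (top_geo m) hy))); lia.
have h1 := topM (topXn m.+2) hD; rewrite addnC mul1r in h1.
apply: top_eq (topB h1 hy') _ _ _ => //; first exact: subr0.
by case: j j2 {hD h1} => [|[|//]] _; rewrite ?addn0 ?addn1 ?geo0 ?geo1 !geoSr !exprS; ring.
Qed.

Lemma pending_next p x y z : (0 < p < n)%N -> st_pending p (x, y, z) -> (1 < a p.+1)%N ->
  exists k d e m f, [/\ top k d y, unitc d, top k e ('X * z), unitc f &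
    top (k + m.+2) f ('X^(a p.+1) * x - 'X * geo (a p.+1) * y)].
Proof.
move=> pn [[bp cp gz] [k [d [e [[hy ud hz]]]]]] h ap.
have [j [f [j2 ja uf hD]]] := h ap.
exists k, d, e, (a p.+1 - j - 2)%N, f; split=> //.
by have := top_x_pending (a p.+1 - j - 2) j2 hy hD; rewrite (_ : _ + j = a p.+1)%N //; lia.
Qed.

Lemma step_pending p v : (0 < p)%N -> (p.+1 < n)%N -> st_pending p v ->
  st p.+1 (block (a p.+1) (b p.+1) (c p.+1) v).
Proof.
case: v => [[x y] z] p0 pn hT; have [[bp cp gz] _] := hT.
have pn' : (0 < p < n)%N by lia.
have cp' : (0 < c p.+1)%N by apply: (red_c red); lia.
have bp' := red_3213 red pn' bp cp.
have ap := red_212 red pn' bp' cp'.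
have [k [d [e [m [f [hy ud hz uf hx']]]]]] := pending_next pn' hT ap.
rewrite bp' block_b0 /=.
apply: (st_blockA _ hy hx' uf hz) => //; first lia.
(* A following 3 2 would complete 3 2 1^a 2 3 2, so the cancellation clause of [st_tied] is
   vacuous. *)
move=> c1; have a2 := red_2121 red p0 pn bp' c1; split=> // pn2 b2.
have := red_321232 red p0 pn bp cp bp' c1 a2 b2.
by have := red_c red (pn2 : (0 < p.+2 < n)%N); lia.
Qed.

Lemma fin_pending p v : (0 < p)%N -> p.+1 = n -> st_pending p v ->
  good_row (block (a p.+1) (b p.+1) (c p.+1) v).
Proof.
case: v => [[x y] z] p0 pn hT; have [[bp cp gz] [k0 [d0 [e0 [[hy0 ud0 _]] _]]]] := hT.
have pn' : (0 < p < n)%N by lia.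
have bp' := red_3213 red pn' bp cp.
case: (posnP (c p.+1)) => cp'.
  by rewrite cp' bp' block_c0 expr0 mul1r geo0 mul0r addr0 /good_row gz (top_good hy0 ud0) !orbT.
have ap := red_212 red pn' bp' cp'.
have [k [d [e [m [f [hy ud hz uf hx']]]]]] := pending_next pn' hT ap.
rewrite bp' block_b0 /= (top_good hx' uf).
have hz0 : top (k + m.+2) 0 ('X * z) by apply: (top_lt hz); lia.
have hu := topB hx' hz0; rewrite subr0 in hu.
by rewrite (top_good (top_y cp' _ hy hu) uf) //; lia.
Qed.

(** With W = x - y - q^2 z, the identity (1 - q) geo(m) = 1 - q^m turns the new y into q geo(m-1) W
    + x - q^2 z. The inequality puts the first term in degree at least k + 2, above the others. *)
Lemma top_y_tied k j e f x y z m : (2 < m)%N -> (k + 3 <= j + m)%N ->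
  top k e x -> top k 0 ('X * z) -> top j f (x - y - 'X * ('X * z)) ->
  top (j + m.-1) f ('X^m * y + geo m * (x - 'X * ('X * z + y))).
Proof.
case: m => [|[|m]] // _ kj hx hz hW.
have h1 := topM (topXM (top_geo m)) hW.
have hx0 : top (j + m.+1) 0 x by apply: (top_lt hx); lia.
have hz0 : top (j + m.+1) 0 ('X * ('X * z)) by apply: (top_lt (topXM hz)); lia.
rewrite addnC mul1r in h1.
apply: top_eq (topD (topB hx0 hz0) h1) _ _ _ => //=; first by rewrite subr0 add0r.
have eX : 'X^(m.+1) = 1 + 'X * geo m.+1 - geo m.+1 by rewrite -geoSl geoSr; ring.
rewrite (geoSl m.+1) (exprS _ m.+1) eX; ring.
Qed.

Lemma step_tied p v : (0 < p)%N -> (p.+1 < n)%N -> st_tied p v ->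
  st p.+1 (block (a p.+1) (b p.+1) (c p.+1) v).
Proof.
case: v => [[x y] z] p0 pn [[ap gx] [k [d [e [[hy ud hx hz] info]]]]].
have cp : (0 < c p.+1)%N by apply: (red_c red); lia.
have ab : (0 < a p.+1 + b p.+1)%N by apply: (red_ab red); lia.
rewrite ap; case: (ltnP 1 (b p.+1)) => b1; first exact: (st_blockB b1 cp hx hy ud hz).
have {}b1 : b p.+1 = 1%N by lia.
have c2 : (2 < c p.+1)%N by apply: (red_n1 red) => //; lia.
have [j [f [kj uf hW]]] := info pn b1.
by apply: (st_blockB1 b1 _ hx hy hz uf (top_y_tied c2 kj hx hz hW)); lia.
Qed.

Lemma fin_tied p v : (0 < p)%N -> p.+1 = n -> st_tied p v ->
  good_row (block (a p.+1) (b p.+1) (c p.+1) v).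
Proof.
case: v => [[x y] z] p0 pn [[ap gx] [k [d [e [[hy ud hx hz] info]]]]].
have ab : (0 < a p.+1 + b p.+1)%N by apply: (red_ab red); lia.
have bp : (0 < b p.+1)%N by lia.
rewrite ap block_a0 /good_row /= gx.
suff -> : good ('X^(b p.+1) * z + geo (b p.+1) * y) by rewrite !orbT.
by apply: top_mulX_good (top_z bp hz hy) _; rewrite add0r.
Qed.

Lemma step_corner p v : (0 < p)%N -> (p.+1 < n)%N -> st_corner p v ->
  st p.+1 (block (a p.+1) (b p.+1) (c p.+1) v).
Proof.
case: v => [[x y] z] p0 pn [[ap bp _] [-> -> [k [d [hx ud]]]]].
have : (2 < c p.+1)%N by apply: (red_n1 red) => //; lia.
rewrite ap bp /block; case: (c p.+1) => // m m1.
rewrite expr0 geo0 !mulr0 mul1r addr0 add0r !mulr0 !subr0.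
apply: Or41; exists (m + k)%N, d; split; last by split; [left; rewrite bp | rewrite bp].
split=> //; first by apply: top_eq (topM (top_geo m) hx) _ _ _; rewrite ?mul1r.
  by apply: (top_lt hx); lia.
by rewrite mulr0; apply: top0.
Qed.

Lemma step_st p v : (0 < p)%N -> (p.+1 < n)%N -> st p v ->
  st p.+1 (block (a p.+1) (b p.+1) (c p.+1) v).
Proof.
move=> p0 pn [] h; [exact: step_dominant | exact: step_pending
  | exact: step_tied | exact: step_corner].
Qed.

Lemma fin_st p v : (0 < p)%N -> p.+1 = n -> st p v ->
  good_row (block (a p.+1) (b p.+1) (c p.+1) v).
Proof.
move=> p0 pn [] h; [exact: fin_dominant | exact: fin_pending | exact: fin_tied | ].
by case: v h => [[x y] z] [[_ _]]; lia.
Qed.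

(** * Twin rows along the prefixes 1^a 2 (1 3 2 2)^k *)

(* The three rows after 1^a 2 (1 3 2 2)^k.  On the third one, x - y - q z is   *)
(* multiplied by -q^2 by each 1 3 2 2, and the final alternative alternates    *)
(* with the parity of k.  It is only needed when the word ends in 1 3 2.       *)
Definition st_twin (p : nat) (v1 v2 v3 : vec) : Prop :=
  [/\ [\/ [/\ p = 1%N, (0 < a 1)%N, b 1 = 0%N & c 1 = 1%N] | (0 < b p)%N],
      exists u k d, [/\ v1 = (u, u, 0), top k d u & unitc d],
      exists w k d, [/\ v2 = (0, - ('X * w), w), top k d w & unitc d] &
      exists x y z k d, [/\ v3 = (x, y, z), top k d (x - y - 'X * z), unitc d &
        top k 0 ('X * z) \/ top k (- d) (y + 'X * z)]].

(** The first sigma_1 sends (u, u, 0) to (0, u, 0). *)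
Lemma block_uu m l k u : block m.+1 l k (u, u, 0) = block m l k (0, u, 0).
Proof. by rewrite /block !geoSr exprS; congr (_, _, _); ring. Qed.

Lemma step_twin p v1 v2 v3 (B := block (a p.+1) (b p.+1) (c p.+1)) :
  (0 < p)%N -> (p.+1 < n)%N -> st_twin p v1 v2 v3 ->
  [\/ st p.+1 (B v1), st p.+1 (B v2) | st_twin p.+1 (B v2) (B v1) (B v3)].
Proof.
move=> p0 pn [flag [u [k [d [-> hu ud]]]] [w [k' [d' [-> hw ud']]]] hv3].
have pn' : (0 < p < n)%N by lia.
have cp : (0 < c p.+1)%N by apply: (red_c red); lia.
have ab : (0 < a p.+1 + b p.+1)%N by apply: (red_ab red); lia.
have t0 j : top j 0 ('X * 0) by rewrite mulr0; apply: top0.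
case: (posnP (a p.+1)) => ap.
  case: (ltnP 1 (b p.+1)) => b1.
    by apply: Or31; rewrite /B ap; apply: (st_blockB b1 cp hu hu ud (t0 k)).
  have {}b1 : b p.+1 = 1%N by lia.
  (* sigma_3 kills the last entry of (0, -q w, w), leaving y alone. *)
  apply: Or32; rewrite /B ap b1 /block !expr0 expr1 geo0 geo1 !(mulr0, mul0r, mul1r).
  rewrite [_ * w - _]subrr mulr0 !subr0 mulr0 addr0.
  apply: Or41; exists (c p.+1 + k'.+1)%N, (- d'); rewrite mulr0.
  split; last by rewrite b1; split; [left | ].
  split; rewrite ?unitcN //; [|exact: top0|exact: top0].
  by apply: top_eq (topM (topXn _) (topN (topXM hw))) _ _ _; rewrite ?mul1r.
case: (posnP (b p.+1)) => bp.
  have a1 : (1 < a p.+1)%N by apply: (red_212 red).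
  (* [v2] suffices unless the tie after 1^a 2 is followed by 3 2^c. Then [v1] is taken; its y
     vanishes if a = 2, which is [st_corner]. *)
  have [/and3P[/eqP c1 /eqP b2 pn2]|nO] :=
      boolP [&& c p.+1 == 1%N, b p.+2 == 1%N & (p.+2 < n)%N].
    have a2 := red_2121 red p0 pn bp c1.
    have lc := red_n2 red (isT : (0 < p.+1)%N) pn2 c1 a2 b2.
    apply: Or31; rewrite /B bp; move: a1 lc; case Ea: (a p.+1) => [|[|m]] // _ lc.
    rewrite block_uu block_b0 mulr0 sub0r /=.
    case: m Ea lc => [|m] Ea lc.
      apply: Or44; rewrite c1 geo1 !expr1 !mulr0 !mul1r !mulr1 subr0 subrr.
      by split=> //; split=> //; exists k.+1, (- d); rewrite unitcN; split=> //; exact/topN/topXM.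
    have hx : top (k + m.+2) (- d) (- ('X * geo m.+2 * u)).
      apply: topN; apply: top_eq (topM (topXM (top_geo m.+1)) hu) _ _ _; rewrite ?mul1r //.
      by rewrite addnC.
    apply: (st_blockA _ hu hx _ (t0 k)) => //; [by rewrite unitcN | lia |].
    move=> _; split=> // _ _; exists k.+1, d; split=> //; first lia.
    by rewrite !mulr0 add0r subr0; apply: topXM.
  apply: Or32; rewrite /B bp block_b0 mulr0 sub0r /=.
  have hx : top (k'.+1 + a p.+1) d' (- ('X * geo (a p.+1) * - ('X * w))).
    rewrite mulrN opprK; move: a1; case: (a p.+1) => // m _.
    apply: top_eq (topM (topXM (top_geo m)) (topXM hw)) _ _ _; rewrite ?mul1r //.
    by rewrite addnC.
  apply: (st_blockA _ (topN (topXM hw)) hx _ (topXM hw)) => //; first lia.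
  move=> c1; split; first exact: (red_2121 red).
  by move=> pn2 b2; move: nO; rewrite c1 b2 pn2.
move: (ap); case Ea: (a p.+1) => [|m] // _.
case: (posnP m) => m0; last first.
  apply: Or31; rewrite /B Ea block_uu.
  apply: (st_blockC _ _ _ hu ud (top0 k) (t0 k)) => // [c1 bm|c1 m1 b1].
    by apply: (red_n3 red) => //; lia.
  by split; [apply: (red_n3 red) => //; lia | rewrite mulr0].
rewrite m0 in Ea => {m m0}.
case: (ltnP 1 (b p.+1)) => b1.
  by apply: Or31; rewrite /B Ea block_uu; apply: (st_blockB b1 cp (top0 k) hu ud (t0 k)).
have {}b1 : b p.+1 = 1%N by lia.
case: (ltngtP (c p.+1) 2) => c2.
(* After 1 3 2, a sigma_1 would create 3 2^k 1 3 2 1 or a left factor [Delta], and a sigma_3 would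
   create 3 2 3; so the word could not go on. *)
- have c1 : c p.+1 = 1%N by lia.
  have a2 : a p.+2 = 0%N.
    case: flag => [[p1 a1 b10 c10]|bp0]; last exact: (red_321321 red p0).
    by move: Ea b1 c1 pn; rewrite p1 => *; apply: (red_Delta red).
  have b2 : b p.+2 = 0%N by apply: (red_3213 red) => //; lia.
  by have := red_ab red (pn : (1 < p.+2 <= n)%N); rewrite a2 b2.
- apply: Or31; rewrite /B Ea block_uu.
  have hy' := top_yB1 (ltnW c2) (top0 k) hu (top_eq (t0 k) erefl erefl (congr1 _ (esym (mulr0 _)))).
  by apply: (st_blockB1 b1 _ (top0 k) hu (t0 k) _ hy'); [lia | rewrite unitcN].
(* 1 3 2 2 sends (u, u, 0) to (0, -q u, u) and (0, -q w, w) to (q^2 w, q^2 w, 0), so the twins trade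
   places. *)
apply: Or33; rewrite /B Ea b1 c2; split; first by right; rewrite b1.
- exists ('X * ('X * w)), k'.+2, d'; split=> //; last exact/topXM/topXM.
  by rewrite /block !geoSr geo0 !exprS expr0; congr (_, _, _); ring.
- exists u, k, d; split=> //.
  by rewrite /block !geoSr geo0 !exprS expr0; congr (_, _, _); ring.
have [x [y [z [k3 [d3 [-> hmu ud3 par]]]]]] := hv3.
rewrite /block !geoSr geo0 !exprS expr0.
do 3 eexists; exists k3.+2, (- d3); split; first reflexivity.
- by apply: top_eq (topN (topXM (topXM hmu))) _ _ _ => //; ring.
- by rewrite unitcN.
case: par => par; last first.
  by left; apply: top_eq (top_lt (topXM par) (ltnSn _)) _ _ _ => //; ring.
right; rewrite opprK.
have h1 : top k3.+2 0 ('X * (x - y - 'X * z)) by apply: (top_lt (topXM hmu)).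
have h2 : top k3.+2 0 ('X * ('X * z)) by apply: (top_lt (topXM par)).
apply: top_eq (topD (topD h1 h2) (topXM (topXM hmu))) _ _ _ => //.
  by rewrite !add0r.
by ring.
Qed.

Lemma fin_twin p v1 v2 v3 (B := block (a p.+1) (b p.+1) (c p.+1)) :
  (0 < p)%N -> p.+1 = n -> st_twin p v1 v2 v3 ->
  [\/ good_row (B v1), good_row (B v2) | good_row (B v3)].
Proof.
move=> p0 pn [flag [u [k [d [-> hu ud]]]] [w [k' [d' [-> hw ud']]]] hv3].
have pn' : (0 < p < n)%N by lia.
have ab : (0 < a p.+1 + b p.+1)%N by apply: (red_ab red); lia.
have t0 j : top j 0 ('X * 0) by rewrite mulr0; apply: top0.
have gu := top_good hu ud.
have gw : good (- ('X * w)) by apply: top_good (topN (topXM hw)) _; rewrite unitcN.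
have gz : (0 < b p.+1)%N -> good ('X^(b p.+1) * 0 + geo (b p.+1) * u).
  by move=> b0; apply: top_mulX_good (top_z b0 (t0 k) hu) _; rewrite add0r.
case: (posnP (a p.+1)) => ap.
  apply: Or31; apply: fin_tied => //; split=> //.
  by exists k, d, d; split=> [|pn2]; [split=> //; exact: t0 | lia].
have hx : top (k'.+1 + a p.+1) d' ('X^(a p.+1) * 0 - 'X * geo (a p.+1) * - ('X * w)).
  by apply: top_eq (top_x ap (top0 k'.+1) (topN (topXM hw))) _ _ _ => //; rewrite sub0r opprK.
case: (posnP (c p.+1)) => cp.
  case: (posnP (b p.+1)) => bp.
    by apply: Or32; rewrite /B bp cp block_c0 /good_row (top_good hx ud') gw.
  by apply: Or31; rewrite /B cp block_c0 /good_row gu gz // !orbT.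
case: (posnP (b p.+1)) => bp.
  have a1 : (1 < a p.+1)%N by apply: (red_212 red).
  apply: Or32; rewrite /B bp block_b0 /good_row /= (top_good hx ud').
  have hw0 : top (k'.+1 + a p.+1) 0 ('X * w) by apply: (top_lt (topXM hw)); lia.
  have hu' := topB hx hw0; rewrite subr0 in hu'.
  by rewrite (top_good (top_y cp _ (topN (topXM hw)) hu') ud') //; lia.
move: (ap); case Ea: (a p.+1) => [|m] // _.
case: (posnP m) => m0; last first.
  by apply: Or31; rewrite /B Ea block_uu; apply: (good_row_mid m0 bp cp hu ud (top0 k) (t0 k)).
rewrite m0 in Ea => {m m0}.
case: (ltnP 1 (b p.+1)) => b1.
  apply: Or31; rewrite /B Ea block_uu block_a0 /good_row /=.
  by rewrite (top_good (top_yB b1 cp (top0 k) hu (t0 k))) ?unitcN // gz // !orbT.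
have {}b1 : b p.+1 = 1%N by lia.
case: (ltnP 1 (c p.+1)) => c1.
  apply: Or31; rewrite /B Ea b1 block_uu block_a0 expr1 geo1 mul1r /good_row /=.
  have hy' := top_yB1 c1 (top0 k) hu (top_eq (t0 k) erefl erefl (congr1 _ (esym (mulr0 _)))).
  by rewrite (top_good hy') ?unitcN // mulr0 add0r gu !orbT.
(* 1 3 2 reduces the twins to (0, 0, u) and (q^2 w, 0, 0). In the third row y becomes q(x - y - q
   z), and the alternative decides whether x or z accompanies it. *)
have {c1}cp : c p.+1 = 1%N by lia.
have [x [y [z [k3 [d3 [-> hmu ud3 par]]]]]] := hv3.
apply: Or33; rewrite /B Ea b1 cp /block !expr1 !geo1 /good_row.
have gy : good ('X * y + 1 * ('X * x - 'X * 1 * y - 'X * ('X * z + 1 * y))).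
  by apply: (@top_good k3.+1 d3) => //; apply: top_eq (topXM hmu) _ _ _ => //; ring.
rewrite gy andbT; case: par => par; apply/or3P.
  apply: Or31; apply: (@top_good k3.+1 d3) => //.
  by apply: top_eq (topXM (topD hmu par)) _ _ _; rewrite ?addr0 //; ring.
apply: Or33; apply: (@top_good k3 (- d3)); last by rewrite unitcN.
by apply: top_eq par _ _ _ => //; ring.
Qed.

(** * Choice of the row and induction along the word *)

Fixpoint run (v : vec) (p : nat) : vec :=
  if p is q.+1 then block (a p) (b p) (c p) (run v q) else v.

Definition e1 : vec := (1, 0, 0).
Definition e2 : vec := (0, 1, 0).
Definition e3 : vec := (0, 0, 1).

Lemma block_e1 m l k : block m l k e1 = ('X^m, geo k * 'X^m, 0).
Proof. by rewrite /e1 /block; congr (_, _, _); ring. Qed.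

(** The first syllable decides: the first row if c_1 > 1, the second if c_1 = 1 and b_1 > 0, all
    three after 1^a 2 with a > 0. *)
Lemma st_first : (1 < n)%N ->
  [\/ st 1 (run e1 1), st 1 (run e2 1) | st_twin 1 (run e1 1) (run e3 1) (run e2 1)].
Proof.
move=> n1; have cp : (0 < c 1)%N by apply: (red_c red).
have t0 j : top j 0 ('X * 0) by rewrite mulr0; apply: top0.
rewrite /run; case: (ltnP 1 (c 1)) => c1.
  apply: Or31; apply: Or41; rewrite block_e1.
  have hx := topXn (a 1); have := top_geo (c 1).-1; rewrite (ltn_predK c1) => hc.
  exists ((c 1).-1 + a 1)%N, 1; split.
    split; rewrite ?unitc1 //.
      by apply: top_eq (topM hc hx) _ _ _.
    by apply: (top_lt hx); lia.
  by split=> [|_ _ _]; [right; rewrite !mulr0; apply: top0 | apply: top_good hx unitc1].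
have {c1}cp : c 1 = 1%N by lia.
case: (posnP (b 1)) => bp; last first.
  apply: Or32; rewrite /e2; case: (posnP (a 1)) => ap.
    have b1 : (1 < b 1)%N.
      rewrite ltnNge; apply/negP => b1; have b11 : b 1 = 1%N by lia.
      by have := red_n1 red (n1 : (0 < 1 < n)%N) ap b11; lia.
    by rewrite ap; apply: (st_blockB b1 _ (top0 0) top1 unitc1 (t0 0%N)); lia.
  apply: (st_blockC ap bp _ top1 unitc1 (top0 0) (t0 0%N)); first lia.
    by move=> c1 ba; apply: (red_n3 red).
  by move=> c1 a1 b1; split; [apply: (red_n4 red) | rewrite mulr0].
case: (posnP (a 1)) => ap; last first.
  apply: Or33; split; first by left.
  - exists 'X^(a 1), (a 1), 1; split; [|exact: topXn|exact: unitc1].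
    by rewrite /e1 /block bp cp expr0 expr1 geo0 geo1; congr (_, _, _); ring.
  - exists 1, 0%N, 1; split; [|exact: top1|exact: unitc1].
    by rewrite /e3 /block bp cp expr0 expr1 geo0 geo1; congr (_, _, _); ring.
  rewrite /e2 /block bp cp expr0 expr1 geo0 geo1.
  do 3 eexists; exists 1%N, (-1); split; first reflexivity.
  - by apply: top_eq (topN topX) _ _ _ => //; ring.
  - by rewrite unitcN unitc1.
  by left; apply: top_eq (t0 1%N) _ _ _ => //; ring.
(* A lone initial 2 makes the second row (0, q, 0), whose x is not good, as [st_dominant] requires
   before a last syllable without sigma_1; the first row (1, 1, 0) serves there. *)
have [/andP[/eqP a2 /eqP n2]|nn] := boolP ((a 2 == 0)%N && (n == 2%N)).
  apply: Or31; apply: Or43; rewrite /e1 /block ap bp cp.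
  have -> : 'X^0 * 1 - 'X * geo 0 * 0 = 1 :> {poly int} by rewrite expr0; ring.
  split; first by split=> //; apply: top_good top1 unitc1.
  exists 0%N, 1, 1; split; last by rewrite n2.
  split; rewrite ?unitc1 //; [|exact: top1|].
    by apply: top_eq top1 _ _ _ => //; rewrite expr0 expr1 geo1 geo0; ring.
  by apply: top_eq (t0 0%N) _ _ _ => //; rewrite expr0 geo0; ring.
apply: Or32; apply: Or41; rewrite /e2 /block ap bp cp !expr0 expr1 geo1 geo0.
exists 1%N, 1; split.
  split; rewrite ?unitc1 //.
  - by apply: top_eq topX _ _ _ => //; ring.
  - by apply: top_eq (top0 1) _ _ _ => //; ring.
  - by apply: top_eq (top0 1) _ _ _ => //; ring.
split; first by right; apply: top_eq (top0 1) _ _ _ => //; ring.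
by move=> n2 a2; move: nn; rewrite a2 -n2.
Qed.

Lemma good_row_single : n = 1%N -> (0 < a 1 + b 1 + c 1)%N ->
  good_row (run e1 n) \/ good_row (run e2 n).
Proof.
move=> -> abc; rewrite /run; have t0 j : top j 0 ('X * 0) by rewrite mulr0; apply: top0.
case: (posnP (c 1)) => cp.
  right; rewrite /e2 cp block_c0 /good_row (top_good top1 unitc1).
  case: (posnP (a 1)) => ap.
    have bp : (0 < b 1)%N by lia.
    by rewrite (top_mulX_good (top_z bp (t0 0%N) top1)) ?orbT ?add0r ?unitc1.
  by rewrite (top_good (top_x ap (top0 0) top1)) // sub0r unitcN unitc1.
left; rewrite block_e1 /good_row.
have hx := topXn (a 1); have := top_geo (c 1).-1; rewrite (prednK cp) => hc.
by rewrite (top_good hx unitc1) (top_good (topM hc hx)) // mul1r unitc1.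
Qed.

Lemma exists_good_row : (0 < n)%N -> (n = 1%N -> (0 < a 1 + b 1 + c 1)%N) ->
  [\/ good_row (run e1 n), good_row (run e2 n) | good_row (run e3 n)].
Proof.
rewrite leq_eqVlt => /predU1P[/esym En abc | n1 _].
  by case: (good_row_single En (abc En)) => h; [apply: Or31 | apply: Or32].
(* The twins [run e1] and [run e3] occur in either order, since 1 3 2 2 exchanges them. *)
pose ok p := [\/ st p (run e1 p), st p (run e2 p), st p (run e3 p) |
  st_twin p (run e1 p) (run e3 p) (run e2 p) \/ st_twin p (run e3 p) (run e1 p) (run e2 p)].
have okP p : (0 < p < n)%N -> ok p.
  elim: p => // -[_ _|p IHp pn]; first by case: (st_first n1) => h;
    [apply: Or41 | apply: Or42 | apply: Or44; left].
  have p0 : (0 < p.+1)%N by [].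
  have pn' : (p.+2 < n)%N by case/andP: pn.
  case: IHp => [|h|h|h|[h|h]]; first by rewrite /=; lia.
  - exact: Or41 (step_st p0 pn' h).
  - exact: Or42 (step_st p0 pn' h).
  - exact: Or43 (step_st p0 pn' h).
  - by case: (step_twin p0 pn' h) => {}h; [apply: Or41 | apply: Or43 | apply: Or44; right].
  - by case: (step_twin p0 pn' h) => {}h; [apply: Or43 | apply: Or41 | apply: Or44; left].
have En : (n.-1.+1 = n)%N by lia.
have p0 : (0 < n.-1)%N by lia.
rewrite -En /=; have /okP : (0 < n.-1 < n)%N by lia.
case=> [h|h|h|[h|h]].
- exact: Or31 (fin_st p0 En h).
- exact: Or32 (fin_st p0 En h).
- exact: Or33 (fin_st p0 En h).
- by case: (fin_twin p0 En h) => {}h; [apply: Or31 | apply: Or33 | apply: Or32].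
- by case: (fin_twin p0 En h) => {}h; [apply: Or33 | apply: Or31 | apply: Or32].
Qed.

End RowStates.

(** * Rows of the Burau matrix of a word *)

Definition rowv (M : 'M[{poly int}]_3) (i : 'I_3) : vec := (M i s1, M i s2, M i s3).

Lemma rowvM (M : 'M[{poly int}]_3) (i j : 'I_3) : rowv (M * burau_gen j) i =
  let: (x, y, z) := rowv M i in
  if j == s1 then ('X * (x - y), y, z)
  else if j == s2 then (x, x + 'X * (y - z), z) else (x, y, y + 'X * z).
Proof.
rewrite /rowv -mulmxE !mxE !big_ord_recl !big_ord0 /burau_gen.
have -> : lift ord0 ord0 = s2 by apply: val_inj.
have -> : lift ord0 (lift ord0 ord0) = s3 by apply: val_inj.
have -> : ord0 = s1 by apply: val_inj.
by elim/ord3P: j; rewrite /= !mxE /=; move: (M i s1) (M i s2) (M i s3) => x y z;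
  congr (_, _, _); ring.
Qed.

Lemma rowv_nseq (M : 'M[{poly int}]_3) (i j : 'I_3) k :
  rowv (M * \prod_(l <- nseq k j) burau_gen l) i =
  let: (x, y, z) := rowv M i in
  if j == s1 then ('X^k * x - 'X * geo k * y, y, z)
  else if j == s2 then (x, 'X^k * y + geo k * (x - 'X * z), z)
  else (x, y, 'X^k * z + geo k * y).
Proof.
elim: k M => [|k IHk] M.
  rewrite big_nil mulr1 expr0 geo0; case: (rowv M i) => [[x y] z].
  by elim/ord3P: j => /=; congr (_, _, _); ring.
rewrite /= big_cons mulrA IHk rowvM /rowv; move: (M i s1) (M i s2) (M i s3) => x y z.
by elim/ord3P: j {IHk} => /=; rewrite geoSr exprS; congr (_, _, _); ring.
Qed.

Lemma rowv_block_word a b c n i :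
  rowv (\prod_(l <- block_word n a b c) burau_gen l) i = run a b c (rowv 1 i) n.
Proof.
elim: n => [|n IHn]; first by rewrite /block_word big_geq // big_nil.
rewrite /block_word big_nat_recr //= -/(block_word n a b c) !big_cat /= !mulrA.
rewrite !rowv_nseq IHn; case: (run _ _ _ _ _) => [[x y] z] /=.
by congr (_, _, _).
Qed.

Lemma good_row_card t M i : good_row t (rowv M i) ->
  (1 < #|[set j : 'I_3 | (M i j != 0%R) && ~~ (t %| lead_coef (M i j))%Z]|)%N.
Proof.
move=> h; apply/card_gt1P; case/or3P: h => /andP[h1 h2].
- by exists s1, s2; rewrite !inE.
- by exists s1, s3; rewrite !inE.
- by exists s2, s3; rewrite !inE.
Qed.

(** * Artin relations with powers, and the Garside element *)

Section BraidRelations.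

Local Open Scope group_scope.

Lemma artin_power (gT : groupType) (g h : gT) k : g * h * g = h * g * h ->
  g ^+ k * h * g = h * g * h ^+ k.
Proof.
move=> gh; elim: k => [|k IHk]; first by rewrite !expg0 mul1g mulg1.
by rewrite -!mulgA in IHk *; rewrite !expgS -!mulgA IHk !mulgA gh.
Qed.

(** Applied to (sigma_1, sigma_2) and (sigma_2, sigma_3), where the right side starts with the
    smaller generator. *)
Lemma artin_rewrite (gT : groupType) (g h : gT) k : g * h * g = h * g * h ->
  h * g ^+ k.+1 * h * g = g * h * g * g * h ^+ k.
Proof.
move=> gh; rewrite -2!mulgA (mulgA _ h) artin_power // expgS !mulgA; congr (_ * _).
by rewrite -(mulgA h h) -(mulgA h (h * g)) -gh !mulgA -gh.
Qed.

Lemma sigma121 : sigma s1 * sigma s2 * sigma s1 = sigma s2 * sigma s1 * sigma s2.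
Proof. by have := sigma_artin Artin12; rewrite !big_cons big_nil !mulg1 !mulgA. Qed.

Lemma sigma232 : sigma s2 * sigma s3 * sigma s2 = sigma s3 * sigma s2 * sigma s3.
Proof. by have := sigma_artin Artin23; rewrite !big_cons big_nil !mulg1 !mulgA. Qed.

Lemma sigma13 : sigma s1 * sigma s3 = sigma s3 * sigma s1.
Proof. by have := sigma_artin Artin13; rewrite !big_cons big_nil !mulg1. Qed.

Lemma sigma1X3 k : sigma s1 ^+ k * sigma s3 = sigma s3 * sigma s1 ^+ k.
Proof. by apply/esym/commuteX/esym/sigma13. Qed.

Lemma prod_nseq k i : \prod_(l <- nseq k i) sigma l = sigma i ^+ k.
Proof. by elim: k => [|k IHk]; rewrite ?big_nil ?expg0 //= big_cons IHk expgS. Qed.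

(** D = sigma_1 sigma_2 sigma_3 satisfies D sigma_1 = sigma_2 D and D sigma_2 = sigma_3 D; both
    sides equal sigma_3 D^2. *)
Lemma sigma1_Delta : sigma s1 * Delta = Delta * sigma s3.
Proof.
have h1 : sigma s1 * sigma s2 * sigma s3 * sigma s1 =
          sigma s2 * (sigma s1 * sigma s2 * sigma s3).
  by rewrite -!mulgA -sigma13 !mulgA sigma121.
have h2 : sigma s1 * sigma s2 * sigma s3 * sigma s2 =
          sigma s3 * (sigma s1 * sigma s2 * sigma s3).
  by rewrite -!mulgA [sigma s2 * (_ * _)]mulgA sigma232 !mulgA sigma13.
have -> : Delta * sigma s3 =
    (sigma s1 * sigma s2 * sigma s3) * (sigma s1 * sigma s2 * sigma s3) * sigma s1.
  by rewrite /Delta -!mulgA sigma13.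
rewrite -[X in _ = X]mulgA h1 [X in _ = X]mulgA h2.
have -> : Delta = (sigma s1 * sigma s2 * sigma s3 * sigma s2) * sigma s1 * sigma s2.
  by rewrite /Delta -!mulgA; congr (_ * (_ * (_ * _))); rewrite !mulgA sigma121.
rewrite h2 -[X in _ = X]mulgA; set D := sigma s1 * sigma s2 * sigma s3 in h1 *.
rewrite -[sigma s3 * D * _]mulgA h1 !mulgA sigma13.
by rewrite -!mulgA in h2 *; rewrite h2.
Qed.

(** 1 2 1 3 2 1 is [Delta] because 1 3 = 3 1, and each further 1 crosses it as a 3. *)
Lemma word_Delta k w :
  \prod_(l <- nseq k.+1 s1 ++ [:: s2; s1; s3; s2; s1] ++ w) sigma l =
  Delta * \prod_(l <- nseq k s3 ++ w) sigma l.
Proof.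
rewrite !big_cat /= !prod_nseq !big_cons big_nil !mulg1.
have swap m : sigma s1 ^+ m * Delta = Delta * sigma s3 ^+ m.
  elim: m => [|m IHm]; first by rewrite !expg0 mul1g mulg1.
  by rewrite !expgS -(mulgA (sigma s1)) IHm mulgA sigma1_Delta mulgA.
rewrite !mulgA -swap prod_nseq -expgS expgSr /Delta !mulgA; congr (_ * _).
by rewrite -!mulgA (mulgA (sigma s1) (sigma s3)) sigma13 -!mulgA.
Qed.

End BraidRelations.

(** * Factors excluded by lexicographic minimality *)

Lemma minimal_factor w x u v (i j : 'I_3) f g : minimal_expansion w x ->
  w = u ++ (i :: f) ++ v -> (j < i)%N ->
  (\prod_(l <- i :: f) sigma l = \prod_(l <- j :: g) sigma l)%g -> False.
Proof.
move=> [xw wmin] Ew ji fg.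
have := wmin (u ++ (j :: g) ++ v).
rewrite /expansion xw Ew !big_cat /= fg => /(_ erefl).
elim: u {xw wmin Ew fg} => [|k u IHu] /=.
  by rewrite Order.SeqLexiOrder.lexi_cons leEord leqNgt ji.
by rewrite Order.SeqLexiOrder.lexi_cons lexx.
Qed.

Lemma nseqSr (T : Type) k (i : T) : nseq k.+1 i = nseq k i ++ [:: i].
Proof. by rewrite -addn1 nseqD. Qed.

Definition syllable (a b c : nat -> nat) (p : nat) : seq 'I_3 :=
  nseq (a p) s1 ++ nseq (b p) s3 ++ nseq (c p) s2.

Definition tail (a b c : nat -> nat) (p n : nat) : seq 'I_3 :=
  \big[cat/[::]]_(p.+1 <= i < n.+1) syllable a b c i.

Lemma block_wordE n a b c p : (p <= n)%N ->
  block_word n a b c = block_word p a b c ++ tail a b c p n.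
Proof. by move=> pn; rewrite /block_word (@big_cat_nat _ _ _ p.+1). Qed.

Lemma tailE n a b c p : (p < n)%N ->
  tail a b c p n = syllable a b c p.+1 ++ tail a b c p.+1 n.
Proof. by move=> pn; rewrite /tail (big_ltn (pn : (p.+1 < n.+1)%N)). Qed.

Lemma minimal_form_reduced x n a b c :
  minimal_form x n a b c -> Delta_indivisible x ->
  (forall p, (0 < p < n)%N ->
    [/\ a p = 0%N -> b p = 1%N -> c p <> 1%N /\ c p <> 2%N,
      (2 <= p)%N -> a p = 0%N -> b p = 1%N -> (c p <= a p.-1 + 1)%N -> c p.-1 <> 1%N,
      (0 < b p)%N -> (b p + 1 <= a p)%N -> c p = 1%N -> a p.+1 <> 2%N
    & a p = 1%N -> b p = 1%N -> c p = 1%N -> a p.+1 <> 2%N]) ->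
  reduced n a b c.
Proof.
move=> [wmin ab cpos] xD normal.
(* The word is cut after syllable [p], and the forbidden factor is sought in the tail, after [u]. *)
have bad p (i j : 'I_3) u f g v : (p <= n)%N ->
    tail a b c p n = u ++ (i :: f) ++ v -> (j < i)%N ->
    (\prod_(l <- i :: f) sigma l = \prod_(l <- j :: g) sigma l)%g -> False.
  move=> pn Et; apply: (minimal_factor (u := block_word p a b c ++ u) (v := v) wmin).
  by rewrite (block_wordE _ _ _ pn) Et catA.
have prodE := (prod_nseq, big_cat, big_cons, big_nil, @mulg1 B4, @mulgA B4).
split=> //.
- move=> [|p] // /andP[_ pn] bp cp; rewrite ltnNge; apply/negP => ap.
  have {}ap : a p.+2 = 1%N by have := ab p.+2; lia.
  have := cpos p.+1 pn; case Ec: (c p.+1) => [|k] // _.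
  move: cp; case Ec2: (c p.+2) => [|k'] // _.
  apply: (bad p s2 s1 (nseq (a p.+1) s1 ++ nseq (b p.+1) s3 ++ nseq k s2)
    [:: s1; s2] [:: s2; s1] (nseq k' s2 ++ tail a b c p.+2 n)) => //.
  + by lia.
  + rewrite (tailE _ _ _ (ltnW pn)) (tailE _ _ _ pn) /syllable Ec nseqSr Ec2 ap bp.
    by rewrite /= -!catA /= -?catA.
  + by rewrite !prodE sigma121.
- move=> [|p] // _ pn bp cp; case Ea: (a p.+3) => [|k3] //.
  have pn1 : (p.+1 < n)%N by lia.
  have := cpos p.+1 pn1; case Ec: (c p.+1) => [|k] // _.
  have := ab p.+2; rewrite bp addn0; case Ea2: (a p.+2) => [|k2] ap2; first by lia.
  exfalso; apply: (bad p s2 s1 (nseq (a p.+1) s1 ++ nseq (b p.+1) s3 ++ nseq k s2)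
    (nseq k2.+1 s1 ++ [:: s2; s1]) ([:: s2; s1; s1] ++ nseq k2 s2)
    (nseq k3 s1 ++ nseq (b p.+3) s3 ++ nseq (c p.+3) s2 ++ tail a b c p.+3 n)) => //.
  + by lia.
  + rewrite (tailE _ _ _ (ltnW pn1)) (tailE _ _ _ pn1) (tailE _ _ _ pn).
    by rewrite /syllable Ec nseqSr Ea2 bp cp Ea /= -!catA /= -?catA.
  + by rewrite !prodE (artin_rewrite _ sigma121).
(* 3 2 1^a 3 = 3 2 3 1^a = 2 3 2 1^a. *)
- move=> [|p] // /andP[_ pn]; case Eb: (b p.+1) => [|k] // _ cp.
  case Eb2: (b p.+2) => [|k2] //; exfalso.
  apply: (bad p s3 s2 (nseq (a p.+1) s1 ++ nseq k s3)
    ([:: s2] ++ nseq (a p.+2) s1 ++ [:: s3]) ([:: s3; s2] ++ nseq (a p.+2) s1)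
    (nseq k2 s3 ++ nseq (c p.+2) s2 ++ tail a b c p.+2 n)) => //.
  + by lia.
  + rewrite (tailE _ _ _ (ltnW pn)) (tailE _ _ _ pn).
    by rewrite /syllable Eb nseqSr cp Eb2 /= -!catA /= -?catA.
  + rewrite !prodE; set A := (sigma s1 ^+ _)%g.
    by rewrite -(mulgA _ A) sigma1X3 mulgA -sigma232.
- move=> [|p] // /andP[_ pn]; case Eb: (b p.+1) => [|k] // _ ap bp.
  case Ec2: (c p.+2) => [|k2] //; exfalso.
  have := cpos p.+1 pn; case Ec: (c p.+1) => [|k1] // _.
  apply: (bad p s3 s2 (nseq (a p.+1) s1 ++ nseq k s3)
    (nseq k1.+1 s2 ++ [:: s3; s2]) ([:: s3; s2; s2] ++ nseq k1 s3)
    (nseq k2 s2 ++ tail a b c p.+2 n)) => //.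
  + by lia.
  + rewrite (tailE _ _ _ (ltnW pn)) (tailE _ _ _ pn).
    by rewrite /syllable Eb nseqSr Ec ap bp Ec2 /= -!catA /= -?catA.
  + by rewrite !prodE (artin_rewrite _ sigma232).
(* 1 3 2 1 = 3 2 1 2, which exposes 3 2^k 3 2. *)
- move=> [|p] // _ pn; case Eb: (b p.+1) => [|k] // _ ap bp cp.
  have pn1 : (p.+1 < n)%N by lia.
  case Ea: (a p.+3) => [|k3] //; exfalso.
  have := cpos p.+1 pn1; case Ec: (c p.+1) => [|k1] // _.
  apply: (bad p s3 s2 (nseq (a p.+1) s1 ++ nseq k s3)
    (nseq k1.+1 s2 ++ [:: s1; s3; s2; s1])
    ([:: s3; s2; s2] ++ nseq k1 s3 ++ [:: s1; s2])
    (nseq k3 s1 ++ nseq (b p.+3) s3 ++ nseq (c p.+3) s2 ++ tail a b c p.+3 n)) => //.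
  + by lia.
  + rewrite (tailE _ _ _ (ltnW pn1)) (tailE _ _ _ pn1) (tailE _ _ _ pn).
    by rewrite /syllable Eb nseqSr Ec ap bp cp Ea /= -!catA /= -?catA.
  + rewrite !prodE -(artin_rewrite _ sigma232); set P := (sigma s3 * _)%g.
    by rewrite -(mulgA P) sigma13 -!mulgA (mulgA (sigma s1)) sigma121 !mulgA.
(* 3 2 1^a 2 3 2 = 3 2 1^a 3 2 3 = 3 2 3 1^a 2 3 = 2 3 2 1^a 2 3. *)
- move=> [|p] // _ pn; case Eb: (b p.+1) => [|k] // _ cp bp2 cp2 ap3 bp3.
  have pn1 : (p.+1 < n)%N by lia.
  case Ec: (c p.+3) => [|k3] //; exfalso.
  apply: (bad p s3 s2 (nseq (a p.+1) s1 ++ nseq k s3)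
    ([:: s2] ++ nseq (a p.+2) s1 ++ [:: s2; s3; s2])
    ([:: s3; s2] ++ nseq (a p.+2) s1 ++ [:: s2; s3])
    (nseq k3 s2 ++ tail a b c p.+3 n)) => //.
  + by lia.
  + rewrite (tailE _ _ _ (ltnW pn1)) (tailE _ _ _ pn1) (tailE _ _ _ pn).
    by rewrite /syllable Eb nseqSr cp bp2 cp2 ap3 bp3 Ec /= -!catA /= -?catA.
  + rewrite !prodE; set A := (sigma s1 ^+ _)%g.
    rewrite -!mulgA (mulgA (sigma s2) (sigma s3)) sigma232 !mulgA.
    by rewrite -(mulgA _ A) sigma1X3 !mulgA -sigma232.
- move=> n2 a1 b1 c1 a2 b2 c2; case Ea3: (a 3) => [|k3] //; exfalso.
  case: wmin => xw _; move: a1 xw; case Ea1: (a 1) => [|k] // _.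
  have n1 := ltnW n2; have n0 := ltnW n1.
  rewrite /expansion (block_wordE _ _ _ (leq0n n)) /block_word big_geq //.
  rewrite (tailE _ _ _ n0) (tailE _ _ _ n1) (tailE _ _ _ n2) /syllable.
  rewrite Ea1 b1 c1 a2 b2 c2 Ea3 /= -!catA /=.
  set w := nseq k3 s1 ++ _; have := word_Delta k w; rewrite /= => -> Ex.
  by apply: xD Ex; exists (nseq k s3 ++ w).
- move=> p pn ap bp; have [/(_ ap bp)[h1 h2] _ _ _] := normal p pn.
  by have := cpos p pn; lia.
- move=> p p0 pn cp ap bp; rewrite ltnNge; apply/negP => cle.
  have [_ h _ _] := normal p.+1 (pn : (0 < p.+1 < n)%N).
  exact: h cle cp.
- by move=> p pn bp ab' cp; have [_ _ h _] := normal p pn; apply: h => //; rewrite addn1.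
- by move=> p pn ap bp cp; have [_ _ _ h] := normal p pn; apply: h.
Qed.

Theorem theorem2p9 (t : nat) (x : B4) :
  prime t -> t <> 2%N -> x <> 1%g ->
  normal_braid x -> Delta_indivisible x ->
  exists M : 'M[{poly int}]_3, burau x = map_mx tofracX M /\
  exists i : 'I_3,
    (1 < #|[set j : 'I_3 |
             (M i j != 0%R) && ~~ (t %| lead_coef (M i j))%Z]|)%N.
Proof.
move=> t_prime t_odd x1 [n [a [b [c [xmin normal]]]]] xD.
have red := minimal_form_reduced xmin xD normal.
have [[xw _] _ _] := xmin.
exists (\prod_(l <- block_word n a b c) burau_gen l); split.
  by rewrite xw sigma_prod burau_pi burau_gword_pos.
have wn0 : block_word n a b c <> [::].
  by move=> w0; apply: x1; rewrite xw w0 big_nil.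
have n0 : (0 < n)%N.
  by case: n wn0 {xmin normal red xw} => // -[]; rewrite /block_word big_geq.
have abc : n = 1%N -> (0 < a 1 + b 1 + c 1)%N.
  move=> n1; rewrite lt0n; apply/negP; rewrite !addn_eq0 => /andP[/andP[a0 b0] c0].
  apply: wn0; rewrite n1 /block_word big_nat1.
  by rewrite (eqP a0) (eqP b0) (eqP c0).
have rowE i := rowv_block_word a b c n i.
have e1E : rowv 1 s1 = e1 by rewrite /rowv !mxE.
have e2E : rowv 1 s2 = e2 by rewrite /rowv !mxE.
have e3E : rowv 1 s3 = e3 by rewrite /rowv !mxE.
case: (exists_good_row t_prime t_odd red n0 abc) => h.
- by exists s1; apply: good_row_card; rewrite rowE e1E.
- by exists s2; apply: good_row_card; rewrite rowE e2E.
- by exists s3; apply: good_row_card; rewrite rowE e3E.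
Qed.
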